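(* There is an algorithm running in $O(m^3n^3)$ time that, given an instance of BQAP1, outputs a feasible solution, and whose domination number is $\Omega(m^{n-1}n^{m-1}+m^{n+1}n+mn^{m+1})$. Likewise, there is an $O(m^3n^3)$-time algorithm for BQAP2 with domination number $\Omega(m^{m-1}n^{n-1}+m^2n^n+m^mn^2)$.
   Context: $M=\{1,\dots,m\}$, $N=\{1,\dots,n\}$. BQAP1 (minimization): data $Q=(q_{ijk\ell})$ ($m\times n\times m\times n$ real array), real $m\times n$ matrices $c,d$; feasible solutions are pairs $(x,y)$ of $m\times n$ 0-1 matrices with $\sum_{j=1}^n x_{ij}=1$ for all $i\in M$ and $\sum_{i=1}^m y_{ij}=1$ for all $j\in N$; objective $f_1(x,y)=\sum_{i,k\in M}\sum_{j,\ell\in N} q_{ijk\ell}x_{ij}y_{k\ell}+\sum_{i\in M,j\in N}c_{ij}x_{ij}+\sum_{i\in M,j\in N}d_{ij}y_{ij}$. BQAP2 (minimization): data $Q$ ($m\times m\times n\times n$ real array), real $m\times m$ matrix $c$, real $n\times n$ matrix $d$; feasible solutions are pairs $(x,y)$ with $x$ an $m\times m$ 0-1 matrix with $\sum_{j=1}^m x_{ij}=1$ for all $i\in M$ and $y$ an $n\times n$ 0-1 matrix with $\sum_{i=1}^n y_{ij}=1$ for all $j\in N$; objective $f_2(x,y)=\sum_{i,j\in M}\sum_{k,\ell\in N} q_{ijk\ell}x_{ij}y_{k\ell}+\sum_{i,j\in M}c_{ij}x_{ij}+\sum_{i,j\in N}d_{ij}y_{ij}$. Domination number of an algorithm $\Gamma$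 outputting $(x^\Gamma,y^\Gamma)$: $\inf_I|\{(x,y)\in\mathcal{F}: f(x,y)\ge f(x^\Gamma,y^\Gamma)\}|$, the infimum over all instances $I$ with size parameters $m,n$, where $\mathcal{F}$ and $f$ are the feasible set and objective of $I$. *)

(* Defs.v *)
From HB Require Import structures.
From mathcomp Require Import all_boot all_order all_algebra.
From mathcomp Require Import reals.
Set Implicit Arguments. Unset Strict Implicit. Unset Printing Implicit Defensive.
Import Order.TTheory GRing.Theory Num.Theory.
Local Open Scope ring_scope.

(* Model of computation: a unit-cost real RAM (BSS-style machine).           *)
(* Two memories: a nat memory N : nat -> nat (addresses/indices/control,     *)
(* only + and truncated - are available, no multiplication, so nat values   *)
(* stay polynomially bounded in bit length) and a real memory X : nat -> R   *)
(* (data; +, -, *, constants 0 and 1, comparison <=).  All real accesses are *)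
(* indirect through nat registers.  Every executed instruction costs 1.      *)

Inductive instr : Type :=
| NConst  (a k : nat)
| NAdd    (a b c : nat)
| NSub    (a b c : nat)
| NLoadI  (a b : nat)
| NStoreI (a b : nat)
| NJlt    (a b l : nat)
| RZero   (a : nat)
| ROne    (a : nat)
| RAdd    (a b c : nat)
| RSub    (a b c : nat)
| RMul    (a b c : nat)
| RJle    (a b l : nat)
| Halt.

Definition program := seq instr.

Record state (R : Type) := State { pc : nat; nmem : nat -> nat; rmem : nat -> R }.

Definition upd {T : Type} (f : nat -> T) (a : nat) (v : T) : nat -> T :=
  fun x => if x == a then v else f x.

Definition halted (P : program) {R : Type} (s : state R) : bool :=
  if nth Halt P (pc s) is Halt then true else false.

Definition step (R : realType) (P : program) (s : state R) : state R :=
  let N := nmem s in let X := rmem s in let p := pc s in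
  match nth Halt P p with
  | NConst a k => State p.+1 (upd N a k) X
  | NAdd a b c => State p.+1 (upd N a (N b + N c)%N) X
  | NSub a b c => State p.+1 (upd N a (N b - N c)%N) X
  | NLoadI a b => State p.+1 (upd N a (N (N b))) X
  | NStoreI a b => State p.+1 (upd N (N a) (N b)) X
  | NJlt a b l => State (if (N a < N b)%N then l else p.+1) N X
  | RZero a => State p.+1 N (upd X (N a) 0)
  | ROne a => State p.+1 N (upd X (N a) 1)
  | RAdd a b c => State p.+1 N (upd X (N a) (X (N b) + X (N c)))
  | RSub a b c => State p.+1 N (upd X (N a) (X (N b) - X (N c)))
  | RMul a b c => State p.+1 N (upd X (N a) (X (N b) * X (N c)))
  | RJle a b l => State (if X (N a) <= X (N b) then l else p.+1) N X
  | Halt => s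
  end.

Fixpoint exec (R : realType) (P : program) (t : nat) (s : state R) : option (state R) :=
  if halted P s then Some s else
  match t with
  | 0 => None
  | t'.+1 => exec P t' (step P s)
  end.

Definition runs_to (R : realType) (P : program) (s0 s : state R) : Prop :=
  exists t, exec P t s0 = Some s.

Definition halts_within (R : realType) (P : program) (t : nat) (s0 : state R) : Prop :=
  exec P t s0 <> None.

(* An instance with size parameters m, n is (Q, c, d); only the values with  *)
(* indices in range (i,k < m, j,l < n) matter.                                *)

Definition feasible1 (m n : nat) (x y : 'M[bool]_(m, n)) : bool :=
  [forall i : 'I_m, (\sum_(j < n) (x i j : nat))%N == 1%N] &&
  [forall j : 'I_n, (\sum_(i < m) (y i j : nat))%N == 1%N].

Definition f1 (R : realType) (m n : nat) (Q : nat -> nat -> nat -> nat -> R)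
    (c d : nat -> nat -> R) (x y : 'M[bool]_(m, n)) : R :=
  \sum_(i < m) \sum_(k < m) \sum_(j < n) \sum_(l < n)
      Q i j k l * (x i j)%:R * (y k l)%:R
  + \sum_(i < m) \sum_(j < n) c i j * (x i j)%:R
  + \sum_(i < m) \sum_(j < n) d i j * (y i j)%:R.

(* Input layout: N[0] = m, N[1] = n, other nat cells 0;
   X[((i*n+j)*m+k)*n+l] = Q i j k l,  X[m^2 n^2 + i*n+j] = c i j,
   X[m^2 n^2 + m n + i*n+j] = d i j, other real cells 0. *)
Definition init1 (R : realType) (m n : nat) (Q : nat -> nat -> nat -> nat -> R)
    (c d : nat -> nat -> R) : state R :=
  State 0
    (fun a => if a == 0%N then m else if a == 1%N then n else 0%N)
    (fun a =>
       let s := (m * n * m * n)%N in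
       if (a < s)%N then
         Q (a %/ (n * m * n))%N ((a %/ (m * n)) %% n)%N ((a %/ n) %% m)%N (a %% n)%N
       else if (a < s + m * n)%N then c ((a - s) %/ n)%N ((a - s) %% n)%N
       else if (a < s + 2 * (m * n))%N then
         d ((a - s - m * n) %/ n)%N ((a - s - m * n) %% n)%N
       else 0).

Definition outx1 (R : Type) (m n : nat) (s : state R) : 'M[bool]_(m, n) :=
  \matrix_(i, j) (nmem s (2 + i * n + j) == 1%N).
Definition outy1 (R : Type) (m n : nat) (s : state R) : 'M[bool]_(m, n) :=
  \matrix_(i, j) (nmem s (2 + m * n + i * n + j) == 1%N).

Definition valid_out1 (R : Type) (m n : nat) (s : state R) : bool :=
  [forall i : 'I_m, forall j : 'I_n,
     (nmem s (2 + i * n + j) < 2)%N && (nmem s (2 + m * n + i * n + j) < 2)%N]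
  && feasible1 (outx1 m n s) (outy1 m n s).

Definition dom_count1 (R : realType) (m n : nat) (Q : nat -> nat -> nat -> nat -> R)
    (c d : nat -> nat -> R) (s : state R) : nat :=
  #|[set p : 'M[bool]_(m, n) * 'M[bool]_(m, n) |
       feasible1 p.1 p.2 &&
       (f1 Q c d (outx1 m n s) (outy1 m n s) <= f1 Q c d p.1 p.2)]|.

Definition bound1 (m n : nat) : nat :=
  (m ^ (n - 1) * n ^ (m - 1) + m ^ (n + 1) * n + m * n ^ (m + 1))%N.

Definition feasible2 (m n : nat) (x : 'M[bool]_m) (y : 'M[bool]_n) : bool :=
  [forall i : 'I_m, (\sum_(j < m) (x i j : nat))%N == 1%N] &&
  [forall j : 'I_n, (\sum_(i < n) (y i j : nat))%N == 1%N].

Definition f2 (R : realType) (m n : nat) (Q : nat -> nat -> nat -> nat -> R)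
    (c d : nat -> nat -> R) (x : 'M[bool]_m) (y : 'M[bool]_n) : R :=
  \sum_(i < m) \sum_(j < m) \sum_(k < n) \sum_(l < n)
      Q i j k l * (x i j)%:R * (y k l)%:R
  + \sum_(i < m) \sum_(j < m) c i j * (x i j)%:R
  + \sum_(i < n) \sum_(j < n) d i j * (y i j)%:R.

(* Input layout: N[0] = m, N[1] = n, other nat cells 0;
   X[((i*m+j)*n+k)*n+l] = Q i j k l,  X[m^2 n^2 + i*m+j] = c i j,
   X[m^2 n^2 + m^2 + i*n+j] = d i j, other real cells 0. *)
Definition init2 (R : realType) (m n : nat) (Q : nat -> nat -> nat -> nat -> R)
    (c d : nat -> nat -> R) : state R :=
  State 0
    (fun a => if a == 0%N then m else if a == 1%N then n else 0%N)
    (fun a =>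
       let s := (m * m * n * n)%N in
       if (a < s)%N then
         Q (a %/ (m * n * n))%N ((a %/ (n * n)) %% m)%N ((a %/ n) %% n)%N (a %% n)%N
       else if (a < s + m * m)%N then c ((a - s) %/ m)%N ((a - s) %% m)%N
       else if (a < s + m * m + n * n)%N then
         d ((a - s - m * m) %/ n)%N ((a - s - m * m) %% n)%N
       else 0).

Definition outx2 (R : Type) (m : nat) (s : state R) : 'M[bool]_m :=
  \matrix_(i, j) (nmem s (2 + i * m + j) == 1%N).
Definition outy2 (R : Type) (m n : nat) (s : state R) : 'M[bool]_n :=
  \matrix_(i, j) (nmem s (2 + m * m + i * n + j) == 1%N).

Definition valid_out2 (R : Type) (m n : nat) (s : state R) : bool :=
  [forall i : 'I_m, forall j : 'I_m, (nmem s (2 + i * m + j) < 2)%N] &&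
  [forall i : 'I_n, forall j : 'I_n, (nmem s (2 + m * m + i * n + j) < 2)%N] &&
  feasible2 (outx2 m s) (outy2 m n s).

Definition dom_count2 (R : realType) (m n : nat) (Q : nat -> nat -> nat -> nat -> R)
    (c d : nat -> nat -> R) (s : state R) : nat :=
  #|[set p : 'M[bool]_m * 'M[bool]_n |
       feasible2 p.1 p.2 &&
       (f2 Q c d (outx2 m s) (outy2 m n s) <= f2 Q c d p.1 p.2)]|.

Definition bound2 (m n : nat) : nat :=
  (m ^ (m - 1) * n ^ (n - 1) + m ^ 2 * n ^ n + m ^ m * n ^ 2)%N.

(* Main.v *)
Require Import Defs.
From HB Require Import structures.
From mathcomp Require Import all_boot all_order all_algebra.
From mathcomp Require Import reals.
From mathcomp Require Import zify.
Set Implicit Arguments. Unset Strict Implicit. Unset Printing Implicit Defensive.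
Import Order.TTheory GRing.Theory Num.Theory.

(* Write a solution as a pair of maps a : I -> J, b : L -> K of cost
     F(a,b) = sum_(i,l) q i (a i) (b l) l + sum_i c i (a i) + sum_l d (b l) l;
   BQAP1 has sizes |I|,|J|,|K|,|L| = m,n,m,n and BQAP2 has m,m,n,n.  For fixed a
   the optimal b splits over l, so it is found in O(|I||K||L|) steps.  The
   algorithm minimises F over all pairs (a,b) with a in the family of maps
     a_{r,s}(i) = 0 if i < r and s otherwise        (r in I, s in J)
   and b arbitrary.  The value v found satisfies
   - v <= F(const s, const t) for all s, t.  Translating a and b cyclically splits
     the solutions into classes of |J||K| elements, and the sum of F is the same
     on every class, including the class of the constant pairs.  Hence every class
     has an element of cost at least v, which gives |J|^(|I|-1) |K|^(|L|-1)
     dominated solutions;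
   - v <= F(a_{r,s}, b) for all b, which gives |I|(|J|-1)|K|^|L| of them.
   For m, n >= 5 the first number exceeds the other two terms of the bound for
   BQAP1.  For BQAP2 with m <= n it exceeds m^m n^2, and the second number covers
   m^2 n^n; for m >= n the roles of a and b are exchanged. *)

(** * Structured programs and their execution *)

(* [SkipLt a b c] runs [c] unless N[a] < N[b], [SkipLe a b c] runs it unless
   X[N[a]] <= X[N[b]]; [DoLt c a b] repeats [c] (at least once) while N[a] < N[b]. *)
Inductive cmd : Type :=
| Ops of seq instr
| Seq of cmd & cmd
| SkipLt of nat & nat & cmd
| SkipLe of nat & nat & cmd
| DoLt of cmd & nat & nat.

Fixpoint csize (c : cmd) : nat :=
  match c with
  | Ops s => size s
  | Seq c1 c2 => csize c1 + csize c2
  | SkipLt _ _ c | SkipLe _ _ c | DoLt c _ _ => (csize c).+1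
  end.

Fixpoint compile (p : nat) (c : cmd) : program :=
  match c with
  | Ops s => s
  | Seq c1 c2 => compile p c1 ++ compile (p + csize c1) c2
  | SkipLt a b c => NJlt a b (p + (csize c).+1) :: compile p.+1 c
  | SkipLe a b c => RJle a b (p + (csize c).+1) :: compile p.+1 c
  | DoLt c a b => rcons (compile p c) (NJlt a b p)
  end.

Lemma size_compile p c : size (compile p c) = csize c.
Proof.
elim: c p => //= [c1 IH1 c2 IH2|a b c IH|a b c IH|c IH a b] p.
- by rewrite size_cat IH1 IH2.
- by rewrite IH.
- by rewrite IH.
- by rewrite size_rcons IH.
Qed.

Definition placed (P : program) (p : nat) (s : seq instr) : Prop :=
  forall k, k < size s -> nth Halt P (p + k) = nth Halt s k.

Lemma placed_cat P p s1 s2 :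
  placed P p (s1 ++ s2) -> placed P p s1 /\ placed P (p + size s1) s2.
Proof.
move=> h; split=> k hk.
  by rewrite h ?size_cat ?ltn_addr // nth_cat hk.
by rewrite -addnA h ?size_cat ?ltn_add2l // nth_cat ltnNge leq_addr /= addKn.
Qed.

Lemma placed_cons P p i s :
  placed P p (i :: s) -> nth Halt P p = i /\ placed P p.+1 s.
Proof.
move=> h; split; first by have := h 0 isT; rewrite addn0.
by move=> k hk; rewrite addSnnS h.
Qed.

(** * Triples with step bounds *)

Section Triples.

Variable R : realType.

Implicit Types (N : nat -> nat) (X : nat -> R).

Definition assertion := (nat -> nat) -> (nat -> R) -> Prop.

(* From memories N, X the code of [c] reaches its end within T steps in memories
   satisfying Q; the code is position dependent since jumps are absolute. *)
Definition wp (c : cmd) (T : nat) (Q : assertion) : assertion := fun N X =>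
  forall P p, placed P p (compile p c) ->
  exists t N' X', [/\ t <= T,
    iter t (@step R P) (State p N X) = State (p + csize c) N' X' & Q N' X'].

(** Symbolic execution of straight-line code; jumps and [Halt] are excluded by [False]. As [upd]
    unfolds under [/=], reads of concrete registers then compute. *)
Fixpoint wp_ops (s : seq instr) (Q : assertion) : assertion := fun N X =>
  match s with
  | [::] => Q N X
  | i :: s' =>
    match i with
    | NConst a k => wp_ops s' Q (upd N a k) X
    | NAdd a b c => wp_ops s' Q (upd N a (N b + N c)) X
    | NSub a b c => wp_ops s' Q (upd N a (N b - N c)) X
    | NLoadI a b => wp_ops s' Q (upd N a (N (N b))) X
    | NStoreI a b => wp_ops s' Q (upd N (N a) (N b)) X
    | RZero a => wp_ops s' Q N (upd X (N a) 0%R)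
    | ROne a => wp_ops s' Q N (upd X (N a) 1%R)
    | RAdd a b c => wp_ops s' Q N (upd X (N a) (X (N b) + X (N c))%R)
    | RSub a b c => wp_ops s' Q N (upd X (N a) (X (N b) - X (N c))%R)
    | RMul a b c => wp_ops s' Q N (upd X (N a) (X (N b) * X (N c))%R)
    | NJlt _ _ _ | RJle _ _ _ | Halt => False
    end
  end.

Lemma wp_opsI s T Q N X : wp_ops s Q N X -> size s <= T -> wp (Ops s) T Q N X.
Proof.
move=> h hT P p; rewrite /csize /=.
elim: s T N X p hT h => [|i s IH] [|T] N X p //= hT h.
- by move=> _; exists 0, N, X; rewrite addn0.
- by move=> _; exists 0, N, X; rewrite addn0.
move=> /placed_cons[hi hs].
suff [N1 [X1 [hst h1]]] : exists N1 X1,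
    step P (State p N X) = State p.+1 N1 X1 /\ wp_ops s Q N1 X1.
  have [t [N' [X' [ht e hQ]]]] := IH T N1 X1 p.+1 hT h1 hs.
  by exists t.+1, N', X'; rewrite iterSr hst e addSnnS.
rewrite /step /= hi; move: h {hi}; case: i => //= *; do 2 eexists;
  (split; [by []|by eassumption]).
Qed.

Lemma wp_conseq c T T' Q Q' N X :
  wp c T Q N X -> (forall N' X', Q N' X' -> Q' N' X') -> T <= T' ->
  wp c T' Q' N X.
Proof.
move=> h hQ hT P p hp; have [t [N' [X' [ht e q]]]] := h P p hp.
by exists t, N', X'; split; [exact: leq_trans hT| |exact: hQ].
Qed.

Lemma wp_seq c1 c2 T1 T2 Q N X :
  wp c1 T1 (wp c2 T2 Q) N X -> wp (Seq c1 c2) (T1 + T2) Q N X.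
Proof.
move=> h P p /= /placed_cat[p1 p2]; rewrite size_compile in p2.
have [t1 [N1 [X1 [ht1 e1 q1]]]] := h P p p1.
have [t2 [N2 [X2 [ht2 e2 q2]]]] := q1 P _ p2.
exists (t2 + t1), N2, X2; split=> //; first by rewrite addnC leq_add.
by rewrite iterD e1 e2 addnA.
Qed.

Lemma wp_skiplt a b c T Q N X :
  (N a < N b -> Q N X) -> (N b <= N a -> wp c T Q N X) ->
  wp (SkipLt a b c) T.+1 Q N X.
Proof.
move=> h1 h2 P p /= /placed_cons[hi hp]; have [hlt|hge] := ltnP (N a) (N b).
  exists 1, N, X; split; [by []|by rewrite /= /step /= hi hlt|exact: h1].
have [t [N' [X' [ht e q]]]] := h2 hge P _ hp.
exists t.+1, N', X'; split=> //; rewrite iterSr -addSnnS -e; congr (iter _ _ _).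
by rewrite /step /= hi ltnNge hge.
Qed.

Lemma wp_skiple a b c T Q N X :
  ((X (N a) <= X (N b))%R -> Q N X) ->
  ((X (N b) < X (N a))%R -> wp c T Q N X) ->
  wp (SkipLe a b c) T.+1 Q N X.
Proof.
move=> h1 h2 P p /= /placed_cons[hi hp].
have [hle|hgt] := lerP (X (N a)) (X (N b)).
  exists 1, N, X; split; [by []|by rewrite /= /step /= hi hle|exact: h1].
have [t [N' [X' [ht e q]]]] := h2 hgt P _ hp.
exists t.+1, N', X'; split=> //; rewrite iterSr -addSnnS -e; congr (iter _ _ _).
by rewrite /step /= hi leNgt hgt.
Qed.

(** Loop rule for exactly n passes: the guard tested after pass k must be true precisely when
    another pass is due. Each pass costs the T steps of the body and one jump. *)
Lemma wp_do (Inv : nat -> assertion) n c a b T Q N X :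
  0 < n -> Inv 0 N X ->
  (forall k N X, k < n -> Inv k N X ->
    wp c T (fun N' X' => Inv k.+1 N' X' /\ (N' a < N' b) = (k.+1 < n)) N X) ->
  (forall N X, Inv n N X -> Q N X) ->
  wp (DoLt c a b) (n * T.+1) Q N X.
Proof.
move=> n0 h0 hI hQ P p /=; rewrite -cats1 => /placed_cat[pc].
rewrite size_compile => /placed_cons[hi _].
(* Induction on the passes still to run: k.+1 of them remain when n - k.+1 are done. *)
suff H k N1 X1 : k < n -> Inv (n - k.+1) N1 X1 ->
    exists t N' X', [/\ t <= k.+1 * T.+1,
     iter t (step P) (State p N1 X1) = State (p + (csize c).+1) N' X' & Q N' X'].
  by have := H n.-1 N X; rewrite prednK // subnn; apply; rewrite ?ltnSn.
elim: k N1 X1 => [|k IH] N1 X1 hk h1.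
  have [|t [N2 [X2 [ht e [i2 hb]]]]] := hI _ _ _ _ h1 P p pc; first by lia.
  have E : (n - 1).+1 = n by lia.
  rewrite E in i2 hb; rewrite ltnn in hb.
  exists t.+1, N2, X2; split; [by rewrite mul1n| |exact: hQ].
  by rewrite iterS e /step /= hi hb addnS.
have [|t [N2 [X2 [ht e [i2 hb]]]]] := hI _ _ _ _ h1 P p pc; first by lia.
have E : (n - k.+2).+1 = n - k.+1 by lia.
rewrite E in i2 hb; have E2 : n - k.+1 < n by lia.
have [|t' [N3 [X3 [ht' e' q]]]] := IH _ _ _ i2; first exact: ltnW.
exists (t' + t.+1), N3, X3; split=> //; first by rewrite mulSn addnC leq_add.
by rewrite iterD iterS e [step P _]/step /= hi hb E2.
Qed.

(* Cells below 64 are registers, and a routine may only change registers from some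
   number p on; callers keep their data in lower registers. *)
Definition frameN p N N' := forall t, (t < p) || (64 <= t) -> N' t = N t.
Definition frameX p X X' := forall t, t < p -> X' t = X t.

Lemma frameN_refl p N : frameN p N N. Proof. by []. Qed.
Lemma frameX_refl p X : frameX p X X. Proof. by []. Qed.

Lemma frameN_upd p N N' a v :
  p <= a < 64 -> frameN p N N' -> frameN p N (upd N' a v).
Proof.
by move=> h f t ht; rewrite /upd ifF ?f //; apply/negbTE; lia.
Qed.

Lemma frameX_upd p X X' a v : p <= a -> frameX p X X' -> frameX p X (upd X' a v).
Proof.
by move=> h f t ht; rewrite /upd ifF ?f //; apply/negbTE; lia.
Qed.

Lemma frameN_trans p q N1 N2 N3 :
  p <= q -> frameN p N1 N2 -> frameN q N2 N3 -> frameN p N1 N3.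
Proof.
move=> pq f g t ht; rewrite g ?f //; case/orP: ht => [h|->]; last by rewrite orbT.
by rewrite (leq_trans h pq).
Qed.

Lemma frameX_trans p q X1 X2 X3 :
  p <= q -> frameX p X1 X2 -> frameX q X2 X3 -> frameX p X1 X3.
Proof. by move=> pq f g t ht; rewrite g ?f // (leq_trans ht pq). Qed.

End Triples.
Arguments upd {T} f a v x /.

(** * The search routine *)

(* Registers 0 and 1 hold m and n.  The strides si .. sl, ci, cj, dk, dl stand for
   the addressing of Q, c and d, so that exchanging the roles of the two maps only
   amounts to loading different strides.  Real scratch cells start at [pbest], just
   after the input. *)
Local Notation zero := 2 (only parsing).
Local Notation one := 3 (only parsing).
Local Notation two := 4 (only parsing).
Local Notation nreg := 5 (only parsing).
Local Notation qsize := 6 (only parsing).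
Local Notation image := 7 (only parsing).
Local Notation pbest := 8 (only parsing).
Local Notation pval := 9 (only parsing).
Local Notation pmin := 10 (only parsing).
Local Notation pw := 11 (only parsing).
Local Notation szI := 12 (only parsing).
Local Notation szJ := 13 (only parsing).
Local Notation szK := 14 (only parsing).
Local Notation szL := 15 (only parsing).
Local Notation si := 16 (only parsing).
Local Notation sj := 17 (only parsing).
Local Notation sk := 18 (only parsing).
Local Notation sl := 19 (only parsing).
Local Notation cb := 20 (only parsing).
Local Notation ci := 21 (only parsing).
Local Notation cj := 22 (only parsing).
Local Notation db := 23 (only parsing).
Local Notation dk := 24 (only parsing).
Local Notation dl := 25 (only parsing).
Local Notation array := 26 (only parsing).
Local Notation s_ := 27 (only parsing).
Local Notation rbest := 28 (only parsing).
Local Notation uqbest := 29 (only parsing).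
Local Notation ucbest := 30 (only parsing).
Local Notation r_ := 31 (only parsing).
Local Notation uq := 32 (only parsing).
Local Notation uc := 33 (only parsing).
Local Notation l_ := 34 (only parsing).
Local Notation lbase := 35 (only parsing).
Local Notation ldbase := 36 (only parsing).
Local Notation parr := 37 (only parsing).
Local Notation k_ := 38 (only parsing).
Local Notation kbase := 39 (only parsing).
Local Notation kdbase := 40 (only parsing).
Local Notation arg := 41 (only parsing).
Local Notation ptr := 42 (only parsing).
Local Notation i_ := 43 (only parsing).
Local Notation tmp := 44 (only parsing).

(** Register [u] holds s times the stride of the chosen index. It is kept up to date by additions,
    since the nat memory cannot multiply; skipping its addition for i < r realises the value 0 of
    the threshold map. *)
Definition rowsum (str u : nat) : cmd :=
  Seq (Ops [:: NConst i_ 0])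
  (DoLt (Seq (Ops [:: NAdd tmp ptr zero])
        (Seq (SkipLt i_ r_ (Ops [:: NAdd tmp tmp u]))
             (Ops [:: RAdd pw pw tmp; NAdd ptr ptr str; NAdd i_ i_ one]))) i_ szI).

Definition wcalc : cmd :=
  Seq (Ops [:: RZero pw; RAdd pw pw kdbase; NAdd ptr kbase zero]) (rowsum si uq).

(** The candidate k = 0 is evaluated before the loop to initialise the minimum. What [arg] remembers
    is not the best k but the address of its d-entry, from which the output cell is obtained by a
    translation. *)
Definition lbody : cmd :=
  Seq (Ops [:: NConst k_ 0; NAdd kbase lbase zero; NAdd kdbase ldbase zero;
               NAdd arg ldbase zero])
  (Seq wcalc
  (Seq (Ops [:: RZero pmin; RAdd pmin pmin pw])
  (Seq (DoLt (Seq wcalc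
             (Seq (SkipLe pmin pw
                    (Ops [:: RZero pmin; RAdd pmin pmin pw; NAdd arg kdbase zero]))
                  (Ops [:: NAdd kbase kbase sk; NAdd kdbase kdbase dk;
                           NAdd k_ k_ one]))) k_ szK)
       (Ops [:: RAdd pval pval pmin; NAdd parr array l_; NAdd lbase lbase sl;
                NAdd ldbase ldbase dl; NAdd l_ l_ one; NStoreI parr arg])))).

Definition eval : cmd :=
  Seq (Ops [:: RZero pw; NAdd ptr cb zero])
  (Seq (rowsum ci uc)
  (Seq (Ops [:: RZero pval; RAdd pval pval pw; NConst l_ 0; NAdd lbase zero zero;
                NAdd ldbase db zero])
       (DoLt lbody l_ szL))).

(** The step bounds keep the shape produced by the rules for [Seq], [SkipLt], [SkipLe] and [DoLt],
    so that they unify with the goals; they are estimated only at the end. *)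
Definition trow (I : nat) := 1 + I * 7.
Definition twcalc (I : nat) := 3 + trow I.
Definition tlbody (I K : nat) :=
  4 + (twcalc I + (2 + (K * (twcalc I + (4 + 3)).+1 + 6))).
Definition teval (I K L : nat) := 2 + (trow I + (5 + L * (tlbody I K).+1)).

Definition save_best : seq instr :=
  [:: RZero pbest; RAdd pbest pbest pval; NAdd rbest r_ zero;
      NAdd uqbest uq zero; NAdd ucbest uc zero].

(** The first evaluation initialises the record. Only r and the multiples of s are recorded, so a
    last evaluation at the best pair rebuilds the array of choices b. *)
Definition search : cmd :=
  Seq (Ops [:: NConst r_ 0; NConst uq 0; NConst uc 0; NConst s_ 0])
  (Seq eval
  (Seq (Ops save_best)
  (Seq (DoLt (Seq (Ops [:: NConst r_ 0])
             (Seq (DoLt (Seq eval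
                        (Seq (SkipLe pbest pval (Ops save_best))
                             (Ops [:: NAdd r_ r_ one]))) r_ szI)
                  (Ops [:: NAdd uq uq sj; NAdd uc uc cj; NAdd s_ s_ one]))) s_ szJ)
  (Seq (Ops [:: NAdd r_ rbest zero; NAdd uq uqbest zero; NAdd uc ucbest zero])
       eval)))).

Definition tsearch (I J K L : nat) :=
  4 + (teval I K L + (5 +
    (J * (1 + (I * (teval I K L + (6 + 1)).+1 + 3)).+1 + (3 + teval I K L)))).

(* The output cells 2, 3, ... overlap the registers.  Hence every 1 of the output is
   written to a copy of the output based at [image], and also to its final place if
   that is not a register; [restore] finally fills cells 2 .. 63 from the copy,
   using cells 0 and 1 only. *)
Definition mark : cmd :=
  Seq (Ops [:: NSub tmp tmp qsize; NAdd tmp tmp two])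
  (Seq (SkipLt tmp nreg (Ops [:: NStoreI tmp one]))
       (Ops [:: NAdd tmp tmp image; NStoreI tmp one])).

Definition output : cmd :=
  Seq (Ops [:: NConst l_ 0])
  (Seq (DoLt (Seq (Ops [:: NAdd parr array l_; NLoadI tmp parr])
             (Seq mark (Ops [:: NAdd l_ l_ one]))) l_ szL)
  (Seq (Ops [:: NConst i_ 0; NAdd ptr cb zero])
       (DoLt (Seq (Ops [:: NAdd tmp ptr zero])
             (Seq (SkipLt i_ r_ (Ops [:: NAdd tmp tmp uc]))
             (Seq mark (Ops [:: NAdd ptr ptr ci; NAdd i_ i_ one])))) i_ szI))).

(** The copying loop is unrolled because a loop would need registers, and these are the cells being
    filled; cell 0 is the read pointer and cell 1 its increment. *)
Fixpoint reload (t n : nat) : seq instr :=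
  if n is n'.+1 then [:: NLoadI t 0, NAdd 0 0 1 & reload t.+1 n'] else [::].

Definition restore (n : nat) : seq instr :=
  [:: NAdd 0 image two, NConst 1 1 & reload 2 n].

Definition main : cmd := Seq search (Seq output (Ops (restore 62))).

Definition tmain (I J K L : nat) :=
  tsearch I J K L +
  (1 + (L * (2 + (6 + 1)).+1 + (2 + I * (1 + (2 + (6 + 2))).+1)) + 126).

(** * Correctness of the search and of the output *)

Section Routines.

Variable R : realType.

Implicit Types (N : nat -> nat) (X : nat -> R).

(** All addresses read lie below [N pw], so the accumulator never feeds back into its own sum; [str]
    and [u] lie below 42 because the loop changes registers from [ptr] on. *)
Lemma rowsum_spec str u N X :
  str < 42 -> u < 42 -> N one = 1 -> N zero = 0 -> 0 < N szI ->
  (forall i, i < N szI ->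
     N ptr + i * N str + (if i < N r_ then 0 else N u) < N pw) ->
  wp (rowsum str u) (trow (N szI)) (fun N' X' =>
    [/\ frameN ptr N N', frameX (N pw) X X' &
        X' (N pw) = (X (N pw) + \sum_(i < N szI)
          X (N ptr + i * N str + (if i < N r_ then 0 else N u))%N)%R]) N X.
Proof.
move=> hstr hu h1 h0 hI hb; apply: wp_seq; apply: wp_opsI => //=.
pose a i := N ptr + i * N str + (if i < N r_ then 0 else N u).
apply: (@wp_do _ (fun k N' X' => [/\ frameN ptr N N', frameX (N pw) X X',
   N' ptr = N ptr + k * N str, N' i_ = k &
   X' (N pw) = (X (N pw) + \sum_(i < k) X (a i))%R])) => //=.
- split=> //; last by rewrite big_ord0 addr0.
    exact: frameN_upd.
  by rewrite mul0n addn0.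
- move=> k N1 X1 hk [fN fX hptr hi hX].
  apply: (@wp_conseq _ _ (1 + (2 + 3)) _
            (fun N2 X2 => [/\ frameN ptr N N2, frameX (N pw) X X2,
      N2 ptr = N ptr + k.+1 * N str, N2 i_ = k.+1 &
      X2 (N pw) = (X (N pw) + \sum_(i < k.+1) X (a i))%R])) => //; last first.
    move=> N2 X2 [f g e1 e2 e3]; split; first by split.
    by rewrite e2 (f szI).
  apply: wp_seq; apply: wp_opsI => //=; rewrite hptr (fN zero) // h0 addn0.
  apply: wp_seq.
  (* Both branches of the test join with [tmp] equal to the address [a k]; the common tail is
     treated once. *)
  suff H N2 : frameN ptr N N2 -> N2 ptr = N ptr + k * N str -> N2 i_ = k ->
     N2 tmp = a k -> wp (Ops [:: RAdd pw pw tmp; NAdd ptr ptr str; NAdd i_ i_ one])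
      3 (fun N' X' => [/\ frameN ptr N N', frameX (N pw) X X',
      N' ptr = N ptr + k.+1 * N str, N' i_ = k.+1 &
      X' (N pw) = (X (N pw) + \sum_(i < k.+1) X (a i))%R]) N2 X1.
    apply: wp_skiplt => /=.
      rewrite hi (fN r_) // => hlt; apply: H => //=; first exact: frameN_upd.
      by rewrite /a hlt addn0.
    rewrite hi (fN r_) // => hge; apply: wp_opsI => //=; apply: H => //=.
      by do 2 apply: frameN_upd => //.
    have -> : (u == tmp) = false by apply/negbTE; lia.
    by rewrite (fN u) ?hu // /a ltnNge hge.
  move=> f e1 e2 e3; apply: wp_opsI => //=.
  rewrite (f str) ?hstr // (f one) // h1 (f pw) // e1 e2 e3 addn1; split=> //.
  - by do 2 apply: frameN_upd => //.
  - exact: frameX_upd.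
  - by rewrite mulSn -addnA [k * _ + _]addnC.
  - by rewrite eqxx hX fX ?hb // big_ord_recr /= addrA.
- by move=> N1 X1 [fN fX _ _ hX]; split.
Qed.

Variables (B : nat -> nat) (X0 : nat -> R).

(** The zones of the nat memory are disjoint: registers below 64, direct output below [pbest] + 2,
    its copy from [image] on, the choices from [array] on. Entries of c and d lie between [qsize]
    and [pbest] in the same order as the output cells of x and y, so address A corresponds to output
    cell A - [qsize] + 2. *)
Record wf : Prop := Wf {
  wf_zero : B zero = 0;
  wf_one : B one = 1;
  wf_two : B two = 2;
  wf_nreg : B nreg = 64;
  wf_image : B image = B pbest + 64;
  wf_array : B array = B image + B image;
  wf_pval : B pval = B pbest + 1;
  wf_pmin : B pmin = B pbest + 2;
  wf_pw : B pw = B pbest + 3;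
  wf_I : 0 < B szI;
  wf_J : 0 < B szJ;
  wf_K : 0 < B szK;
  wf_L : 0 < B szL;
  wf_q : forall i j k l, i < B szI -> j < B szJ -> k < B szK -> l < B szL ->
    k * B sk + l * B sl + i * B si + j * B sj < B pbest;
  wf_c : forall i j, i < B szI -> j < B szJ ->
    B qsize <= B cb + i * B ci + j * B cj < B pbest;
  wf_d : forall k l, k < B szK -> l < B szL ->
    B qsize <= B db + k * B dk + l * B dl < B pbest }.

Hypothesis wfB : wf.

Definition threshold (r s i : nat) : nat := if i < r then 0 else s.

Definition weight (a : nat -> nat) (k l : nat) : R :=
  (X0 (B db + k * B dk + l * B dl)%N +
   \sum_(i < B szI) X0 (k * B sk + l * B sl + i * B si + a i * B sj)%N)%R.

Definition cost (a b : nat -> nat) : R :=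
  (\sum_(i < B szI) X0 (B cb + i * B ci + a i * B cj)%N +
   \sum_(l < B szL) weight a (b l) l)%R.

Definition ctx (r s : nat) (N : nat -> nat) (X : nat -> R) : Prop :=
  [/\ forall t, t < 27 -> N t = B t, frameX (B pbest) X0 X, N r_ = r,
      N uq = s * B sj & N uc = s * B cj].

Lemma ctx_frame r s N X N' X' p q : 33 < p -> B pbest <= q ->
  frameN p N N' -> frameX q X X' -> ctx r s N X -> ctx r s N' X'.
Proof.
move=> hp hq f g [h1 h2 h3 h4 h5].
have e t : t <= 33 -> N' t = N t by move=> ht; rewrite f //; lia.
split; rewrite ?e // => t ht; last by rewrite g ?h2 //; lia.
by rewrite e ?h1 //; lia.
Qed.

Lemma thresholdM r s i x :
  (if i < r then 0 else s * x) = threshold r s i * x.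
Proof. by rewrite /threshold; case: ifP. Qed.

Lemma threshold_lt r s i : s < B szJ -> threshold r s i < B szJ.
Proof. by rewrite /threshold; case: ifP => // _ _; exact: wf_J. Qed.

Lemma wcalc_spec r s k l N X : ctx r s N X ->
  s < B szJ -> k < B szK -> l < B szL ->
  N kbase = k * B sk + l * B sl -> N kdbase = B db + k * B dk + l * B dl ->
  wp wcalc (twcalc (B szI)) (fun N' X' =>
    [/\ frameN ptr N N', frameX (B pw) X X' &
        X' (B pw) = weight (threshold r s) k l]) N X.
Proof.
move=> [cN cX cr cuq cuc] hs hk hl e1 e2.
have /andP[_ hd] := wf_d wfB hk hl.
have hpw := wf_pw wfB.
apply: wp_seq; apply: wp_opsI => //=.
rewrite e1 e2 eqxx !cN // wf_zero // addn0 add0r.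
set N1 := upd _ _ _; set X1 := upd _ _ _.
have g1 : frameX (B pw) X X1.
  by do 2 apply: frameX_upd => //.
have eN t : t < 42 -> N1 t = N t.
  by move=> ht; rewrite /N1 /= ifF //; apply/negbTE; lia.
have eI : N1 szI = B szI by rewrite eN ?cN.
rewrite -{1}eI; apply: wp_conseq (leqnn _).
  apply: (@rowsum_spec si uq) => //.
  - by rewrite (eN one) // cN // wf_one.
  - by rewrite (eN zero) // cN // wf_zero.
  - by rewrite eI wf_I.
  rewrite eI => i hi; rewrite (eN si) // (eN r_) // (eN uq) // (eN pw) //.
  rewrite /N1 /= cr cuq !cN // thresholdM.
  apply: leq_trans (wf_q wfB hi (threshold_lt _ _ hs) hk hl) _.
  by rewrite hpw leq_addr.
move=> N' X' /=; rewrite eI (eN si) // (eN r_) // (eN uq) // (eN pw) //.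
rewrite cr cuq !cN // => -[f g ->]; split=> //.
- by apply: frameN_trans f => //; apply: frameN_upd.
- exact: frameX_trans g1 g.
- rewrite /weight {1}/X1 /= eqxx; congr (_ + _)%R.
    rewrite ifF ?cX //; apply/negbTE; lia.
  apply: eq_bigr => i _; rewrite /N1 /= thresholdM.
  have h := wf_q wfB (ltn_ord i) (threshold_lt r i hs) hk hl.
  by rewrite g1 ?cX //; lia.
Qed.

Lemma lbody_spec r s l N X : ctx r s N X -> s < B szJ -> l < B szL ->
  N l_ = l -> N lbase = l * B sl -> N ldbase = B db + l * B dl ->
  wp lbody (tlbody (B szI) (B szK)) (fun N' X' =>
    [/\ forall t, (t < 34) || (64 <= t) && (t != B array + l) -> N' t = N t,
        frameX (B pval) X X',
        [/\ N' l_ = l.+1, N' lbase = l.+1 * B sl & N' ldbase = B db + l.+1 * B dl] &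
        exists k, [/\ k < B szK, N' (B array + l) = B db + k * B dk + l * B dl,
          X' (B pval) = (X (B pval) + weight (threshold r s) k l)%R &
          forall k', k' < B szK ->
            (weight (threshold r s) k l <= weight (threshold r s) k' l)%R]]) N X.
Proof.
move=> cx hs hl el elb eld; have [cN cX cr cuq cuc] := cx.
have hpw := wf_pw wfB; have hmin := wf_pmin wfB; have hval := wf_pval wfB.
have hK := wf_K wfB.
apply: wp_seq; apply: wp_opsI => //=.
rewrite elb eld !cN // wf_zero // !addn0.
set N1 := upd _ _ _.
have f1 : frameN 38 N N1 by do 4 apply: frameN_upd => //.
have c1 : ctx r s N1 X by apply: ctx_frame f1 (@frameX_refl _ (B pw) X) cx; lia.
apply: wp_seq; apply: wp_conseq (leqnn _).
  by apply: wcalc_spec c1 hs hK hl _ _; rewrite /N1 /= ?mul0n ?addn0.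
move=> N2 X2 [f2 g2 w2].
have e2 t : t < 27 -> N2 t = B t.
  by move=> ht; rewrite f2 ?f1 ?cN //; lia.
have e2' t : t < 42 -> N2 t = N1 t by move=> ht; rewrite f2 ?ht.
apply: wp_seq; apply: wp_opsI => //=.
rewrite !e2 // eqxx add0r.
have -> : (B pw == B pmin) = false by apply/negbTE; lia.
rewrite w2; set X3 := upd _ _ _.
have g3 : frameX (B pmin) X X3.
  do 2 apply: frameX_upd => //; apply: frameX_trans (@frameX_refl _ (B pmin) _) _ => //.
  by move=> t ht; apply: g2; lia.
have fN2 : frameN 38 N N2 by apply: frameN_trans f1 f2.
apply: wp_seq.
pose Inv k (N' : nat -> nat) (X' : nat -> R) :=
  [/\ frameN 38 N N', frameX (B pmin) X X',
     [/\ N' k_ = k, N' kbase = k * B sk + l * B sl &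
         N' kdbase = B db + k * B dk + l * B dl] &
     exists k0, [/\ k0 < B szK, N' arg = B db + k0 * B dk + l * B dl,
       X' (B pmin) = weight (threshold r s) k0 l &
       forall k', k' < k ->
         (weight (threshold r s) k0 l <= weight (threshold r s) k' l)%R]].
apply: (@wp_do _ Inv).
- exact: hK.
- split=> //; first by rewrite !e2' // /N1 /= mul0n addn0.
  exists 0; split=> //; first by rewrite e2' // /N1 /= mul0n addn0.
  by rewrite /X3 /= eqxx.
- move=> k Na Xa hk [fa ga [ek ekb ekd] [k0 [hk0 earg emin hopt]]].
  have ca : ctx r s Na Xa by apply: ctx_frame fa ga cx; lia.
  apply: wp_seq; apply: wp_conseq (leqnn _).
    exact: wcalc_spec ca hs hk hl ekb ekd.
  move=> Nb Xb [fb gb wb].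
  have fab : frameN 38 N Nb by apply: frameN_trans fa fb.
  have gab : frameX (B pmin) X Xb.
    by move=> t ht; rewrite gb ?ga //; lia.
  have eb t : t < 27 -> Nb t = B t.
    by move=> ht; rewrite fab ?cN //; lia.
  have eb' t : t < 42 -> Nb t = Na t by move=> ht; rewrite fb ?ht.
  (* Common end of both branches; k1 is the best candidate after the comparison, either the old k0
     or k. *)
  have hfin k1 Nc Xc : k1 < B szK -> frameN 41 Nb Nc -> frameX (B pmin) X Xc ->
      Nc arg = B db + k1 * B dk + l * B dl ->
      Xc (B pmin) = weight (threshold r s) k1 l ->
      (forall k', k' < k.+1 ->
         (weight (threshold r s) k1 l <= weight (threshold r s) k' l)%R) ->
      wp (Ops [:: NAdd kbase kbase sk; NAdd kdbase kdbase dk; NAdd k_ k_ one]) 3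
        (fun N' X' => Inv k.+1 N' X' /\ (N' k_ < N' szK) = (k.+1 < B szK)) Nc Xc.
    move=> hk1 fc gc e1 e3 ho; apply: wp_opsI => //=.
    have ec t : t < 27 -> Nc t = B t.
      by move=> ht; rewrite fc ?eb //; lia.
    rewrite !(ec sk, ec dk, ec one, ec szK) // wf_one //.
    rewrite !(fc k_, fc kbase, fc kdbase) // !eb' // ek ekb ekd addn1.
    split=> //; split=> //=.
    - do 3 apply: frameN_upd => //.
      by apply: frameN_trans fab fc.
    - by split=> //; nia.
    - by exists k1; split.
  apply: wp_seq; apply: wp_skiple; rewrite !eb // wb gb ?emin; try lia.
    move=> hle; apply: (hfin k0) => //; first by rewrite eb'.
      by rewrite gb //; lia.
    move=> k'; rewrite ltnS leq_eqVlt => /orP[/eqP->//|]; exact: hopt.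
  move=> hlt; apply: wp_opsI => //=.
  rewrite !(eb zero, eb pmin, eb pw) // eqxx add0r (wf_zero wfB) addn0 !eb' // ekd.
  have -> : (B pw == B pmin) = false by apply/negbTE; lia.
  apply: (hfin k) => //=.
  + exact: frameN_upd.
  + by do 2 apply: frameX_upd => //.
  + by rewrite eqxx.
  + move=> k'; rewrite ltnS leq_eqVlt => /orP[/eqP->//|/hopt]; apply: le_trans.
    exact: ltW.
move=> N4 X4 [f4 g4 [ek4 _ _] [k0 [hk0 earg emin hopt]]].
apply: wp_opsI => //=.
have e4 t : t < 27 -> N4 t = B t by move=> ht; rewrite f4 ?cN //; lia.
rewrite !(e4 pval, e4 pmin, e4 array, e4 sl, e4 dl, e4 one) // emin wf_one //.
rewrite !(f4 l_, f4 lbase, f4 ldbase) // el elb eld g4; last lia.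
have hA : 64 <= B array by rewrite wf_array // wf_image //; lia.
split.
- by move=> t ht; rewrite !ifF ?f4 //; try (apply/negbTE); lia.
- by apply: frameX_upd => // t ht; rewrite g4 //; lia.
- by rewrite !ifF; try (apply/negbTE; lia); split; nia.
- by exists k0; split; rewrite /= ?eqxx.
Qed.

(** For a fixed first map, the cost is a constant plus a sum over l of terms that depend on b l
    only, so separate minimisation for each l is optimal among all b. *)
Lemma eval_spec r s N X : ctx r s N X -> s < B szJ ->
  wp eval (teval (B szI) (B szK) (B szL)) (fun N' X' =>
    [/\ forall t, (t < 34) || (64 <= t < B array) -> N' t = N t,
        frameX (B pval) X X' &
        exists b, [/\ forall l, l < B szL ->
            b l < B szK /\ N' (B array + l) = B db + b l * B dk + l * B dl,
          X' (B pval) = cost (threshold r s) b &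
          forall b', (forall l, l < B szL -> b' l < B szK) ->
            (cost (threshold r s) b <= cost (threshold r s) b')%R]]) N X.
Proof.
move=> cx hs; have [cN cX cr cuq cuc] := cx.
have hpw := wf_pw wfB; have hmin := wf_pmin wfB; have hval := wf_pval wfB.
have hA : 64 <= B array by rewrite wf_array // wf_image //; lia.
set a := threshold r s.
apply: wp_seq; apply: wp_opsI => //=.
rewrite !cN // wf_zero // addn0.
set N1 := upd _ _ _; set X1 := upd _ _ _.
have f1 : frameN 42 N N1 by apply: frameN_upd.
have g1 : frameX (B pw) X X1 by apply: frameX_upd.
have e1 t : t < 27 -> N1 t = B t by move=> ht; rewrite f1 ?cN //; lia.
apply: wp_seq; rewrite -{1}(e1 szI) //; apply: wp_conseq (leqnn _).
  apply: (@rowsum_spec ci uc) => //.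
  - by rewrite e1 // wf_one.
  - by rewrite e1 // wf_zero.
  - by rewrite e1 // wf_I.
  move=> i; rewrite !(e1 szI, e1 ci, e1 pw) // /N1 /= cr cuc thresholdM => hi.
  have := wf_c wfB hi (threshold_lt r i hs); lia.
move=> N2 X2 /=; rewrite !(e1 szI, e1 ci, e1 pw) // /N1 /= cr cuc -/N1.
move=> [f2 g2 w2].
have {w2} w2 : X2 (B pw) =
    (\sum_(i < B szI) X0 (B cb + i * B ci + a i * B cj)%N)%R.
  rewrite w2 /X1 /= eqxx add0r; apply: eq_bigr => i _; rewrite thresholdM.
  have := wf_c wfB (ltn_ord i) (threshold_lt r i hs) => h.
  by rewrite ifF ?cX //; [lia | apply/negbTE; lia].
have f12 : frameN 42 N N2 by apply: frameN_trans f1 f2.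
have g12 : frameX (B pval) X X2.
  by move=> t ht; rewrite g2 ?g1 //; lia.
have e2 t : t < 27 -> N2 t = B t by move=> ht; rewrite f12 ?cN //; lia.
apply: wp_seq; apply: wp_opsI => //=.
rewrite !e2 // wf_zero // addn0 eqxx add0r.
have -> : (B pw == B pval) = false by apply/negbTE; lia.
rewrite w2; set N3 := upd _ _ _; set X3 := upd _ _ _.
have f3 : frameN 34 N N3.
  by do 3 apply: frameN_upd => //; apply: frameN_trans (@frameN_refl 34 N) f12.
have g3 : frameX (B pval) X X3 by do 2 apply: frameX_upd => //.
pose Inv l (N' : nat -> nat) (X' : nat -> R) :=
  [/\ forall t, (t < 34) || (64 <= t < B array) -> N' t = N t,
      frameX (B pval) X X',
      [/\ N' l_ = l, N' lbase = l * B sl & N' ldbase = B db + l * B dl] &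
      exists b, [/\ forall l', l' < l ->
          b l' < B szK /\ N' (B array + l') = B db + b l' * B dk + l' * B dl,
        X' (B pval) =
          (\sum_(i < B szI) X0 (B cb + i * B ci + a i * B cj)%N +
           \sum_(l' < l) weight a (b l') l')%R &
        forall l' k, l' < l -> k < B szK ->
          (weight a (b l') l' <= weight a k l')%R]].
apply: (@wp_do _ Inv); first exact: wf_L.
- split=> //; first by move=> t ht; apply: f3; lia.
  (* No l has been treated, so any map serves; each pass then sets the value at its own l. *)
  by exists id; split=> //; rewrite big_ord0 addr0 /X3 /= eqxx.
- move=> l Na Xa hl [fa ga [el elb eld] [b [hb hX hopt]]].
  have ca : ctx r s Na Xa.
    split; try (rewrite fa //; lia).
      by move=> t ht; rewrite fa ?cN //; lia.
    by move=> t ht; rewrite ga ?cX //; lia.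
  apply: wp_conseq (leqnn _); first exact: lbody_spec ca hs hl el elb eld.
  move=> Nb Xb [fb gb [el' elb' eld'] [k [hk hNk hXk hok]]].
  split; last by rewrite el' fb // fa ?cN.
  split=> //.
  + by move=> t ht; rewrite fb ?fa //; lia.
  + by move=> t ht; rewrite gb ?ga.
  exists (upd b l k); split.
  + move=> l'; rewrite ltnS leq_eqVlt /= => /orP[/eqP->|hl'].
      by rewrite eqxx; split.
    rewrite ifF; last by apply/negbTE; lia.
    have [hb1 hb2] := hb _ hl'; split=> //.
    by rewrite fb ?hb2 //; lia.
  + rewrite hXk hX big_ord_recr /= eqxx [RHS]addrA; congr (_ + _ + _)%R.
    apply: eq_bigr => i _; rewrite ifF //; apply/negbTE.
    by have := ltn_ord i; lia.
  + move=> l' k'; rewrite ltnS leq_eqVlt /= => /orP[/eqP->|hl'] hk'.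
      by rewrite eqxx; apply: hok.
    by rewrite ifF; [exact: hopt | apply/negbTE; lia].
move=> Na Xa [fa ga _ [b [hb hX hopt]]]; split=> //.
exists b; split=> // b' hb'; rewrite /cost lerD2l.
by apply: ler_sum => l _; apply: hopt => //; apply: hb'.
Qed.

Definition valid_b (b : nat -> nat) : Prop := forall l, l < B szL -> b l < B szK.

(** The predicate [seen] holds of the pairs (r, s) already tried. The recorded value is attained,
    and it is compared with all second maps since each evaluation is exact in b. *)
Definition best_of (seen : nat -> nat -> bool) N' (X' : nat -> R) : Prop :=
  exists r s b, [/\ s < B szJ,
    [/\ N' rbest = r, N' uqbest = s * B sj & N' ucbest = s * B cj],
    valid_b b, X' (B pbest) = cost (threshold r s) b &
    forall r' s' b', seen r' s' -> valid_b b' ->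
      (X' (B pbest) <= cost (threshold r' s') b')%R].

Lemma save_bestP r s b N X (seen : nat -> nat -> bool) : ctx r s N X ->
  s < B szJ -> valid_b b -> X (B pval) = cost (threshold r s) b ->
  (forall r' s' b', seen r' s' -> valid_b b' ->
      (X (B pval) <= cost (threshold r' s') b')%R) ->
  wp (Ops save_best) 5 (fun N' X' => [/\ frameN 28 N N',
    forall t, 30 < t -> N' t = N t, frameX (B pbest) X X' & best_of seen N' X'])
  N X.
Proof.
move=> [cN cX cr cuq cuc] hs hb hX hopt; have hval := wf_pval wfB.
apply: wp_opsI => //=; rewrite cr cuq cuc !cN // wf_zero // !addn0 eqxx add0r.
have -> : (B pval == B pbest) = false by apply/negbTE; lia.
split.
- by do 3 apply: frameN_upd => //.
- by move=> t ht /=; rewrite !ifF //; apply/negbTE; lia.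
- by do 2 apply: frameX_upd => //.
by exists r, s, b; split; rewrite /= ?eqxx.
Qed.

Lemma search_spec N X : (forall t, t < 27 -> N t = B t) ->
  frameX (B pbest) X0 X ->
  wp search (tsearch (B szI) (B szJ) (B szK) (B szL)) (fun N' X' =>
    (forall t, (t < 27) || (64 <= t < B array) -> N' t = N t) /\
    exists r s b, [/\ s < B szJ, N' r_ = r /\ N' uc = s * B cj,
      valid_b b,
      forall l, l < B szL -> N' (B array + l) = B db + b l * B dk + l * B dl &
      forall r' s' b', r' < B szI -> s' < B szJ -> valid_b b' ->
        (cost (threshold r s) b <= cost (threshold r' s') b')%R]) N X.
Proof.
move=> cN cX.
have hval := wf_pval wfB; have hJ := wf_J wfB; have hI := wf_I wfB.
have hA : 64 <= B array by rewrite wf_array // wf_image //; lia.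
apply: wp_seq; apply: wp_opsI => //=.
set N1 := upd _ _ _.
have f1 : frameN 27 N N1 by do 4 apply: frameN_upd => //.
have c1 : ctx 0 0 N1 X.
  by split=> // t ht; rewrite f1 ?cN ?ht.
apply: wp_seq; apply: wp_conseq (leqnn _); first exact: eval_spec c1 hJ.
move=> N2 X2 [f2 g2 [b0 [hb0 hX2 _]]].
have c2 : ctx 0 0 N2 X2.
  split; rewrite ?f2 // => t ht; last by rewrite g2 ?cX //; lia.
  by rewrite f2 ?f1 ?cN //; lia.
apply: wp_seq; apply: wp_conseq (leqnn _).
  (* Nothing counts as seen yet: this evaluation only supplies a value to compare with, and (0, 0)
     is tried again inside the loops. *)
  apply: (@save_bestP 0 0 b0 _ _ (fun _ _ => false)) => //.
  by move=> l /hb0[].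
move=> N3 X3 [f3 h3 g3 best3].
pose Base (N' : nat -> nat) (X' : nat -> R) :=
  (forall t, (t < 27) || (64 <= t < B array) -> N' t = N t) /\
  frameX (B pbest) X0 X'.
have BaseN N' X' t : Base N' X' -> t < 27 -> N' t = B t.
  by move=> [h _] ht; rewrite h ?cN // ht.
(* The seen pairs form an initial segment for the lexicographic order with s first. *)
pose Outer s N' X' := [/\ Base N' X',
  [/\ N' s_ = s, N' uq = s * B sj & N' uc = s * B cj] &
  best_of (fun r' s' => (s' < s) && (r' < B szI)) N' X'].
pose Inner s r N' X' := [/\ Base N' X',
  [/\ N' s_ = s, N' uq = s * B sj, N' uc = s * B cj & N' r_ = r] &
  best_of (fun r' s' => (s' < s) && (r' < B szI) || (s' == s) && (r' < r)) N' X'].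
apply: wp_seq; apply: (@wp_do _ Outer) => //.
- split; last 1 first.
  + have [r [s [b [h1 h2 h4 h5 _]]]] := best3.
    by exists r, s, b; split.
  + split=> t ht; last by rewrite g3 ?g2 ?cX //; lia.
    by rewrite f3 ?f2 ?f1 //; lia.
  + by rewrite f3 ?(h3 uq) ?(h3 uc) ?f2.
- move=> s N4 X4 hs [base4 [es euq euc] best4].
  apply: wp_seq; apply: wp_opsI => //=.
  apply: wp_seq; apply: (@wp_do _ (Inner s)) => //.
  + have [r [s0 [b [h1 h2 h4 h5 h6]]]] := best4.
    split; [split|by []|exists r, s0, b; split=> //].
    * by move=> t ht; rewrite -(proj1 base4) //= ifF //; apply/negbTE; lia.
    * by have [] := base4.
    * by move=> r' s'; rewrite ltn0 andbF orbF; apply: h6.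
  + move=> r N5 X5 hr [base5 [es5 euq5 euc5 er5] best5].
    have c5 : ctx r s N5 X5.
      by split=> //; [move=> t; exact: BaseN base5|have [] := base5].
    apply: wp_seq; apply: wp_conseq (leqnn _); first exact: eval_spec c5 hs.
    move=> N6 X6 [f6 g6 [b [hb hX6 hopt]]].
    have c6 : ctx r s N6 X6.
      have [hN hX h1 h2 h3'] := c5.
      split; rewrite ?f6 // => t ht; last by rewrite g6 ?hX //; lia.
      by rewrite f6 ?hN //; lia.
    have vb : valid_b b by move=> l /hb[].
    have base6 : Base N6 X6.
      have [hN hX] := base5; split=> t ht; last by rewrite g6 ?hX //; lia.
      by rewrite f6 ?hN //; lia.
    (* The increment of r after the comparison, for a record that already covers (r, s), whether it
       was replaced or kept. *)
    have fin N7 X7 : Base N7 X7 -> (forall t, 30 < t < 34 -> N7 t = N6 t) ->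
        N7 s_ = s ->
        best_of (fun r' s' => (s' < s) && (r' < B szI) || (s' == s) && (r' < r.+1))
          N7 X7 ->
        wp (Ops [:: NAdd r_ r_ one]) 1 (fun N' X' => Inner s r.+1 N' X' /\
          (N' r_ < N' szI) = (r.+1 < B szI)) N7 X7.
      move=> base7 f7 es7 [r0 [s0 [b7 [h1 h2 h4 h5 h6]]]].
      apply: wp_opsI => //=.
      rewrite !(BaseN _ _ one base7, BaseN _ _ szI base7) // wf_one //.
      rewrite (f7 r_) // f6 // er5 addn1; split=> //.
      split; [split| |by exists r0, s0, b7; split].
      * move=> t ht; rewrite -(proj1 base7) //= ifF //; apply/negbTE; lia.
      * by have [] := base7.
      * by rewrite /= es7 (f7 uq) // (f7 uc) // !f6.
    have [r0 [s0 [b0' [k1 [k2 k3 k4] k5 k6 k7]]]] := best5.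
    have epb : X6 (B pbest) = X5 (B pbest) by apply: g6; lia.
    apply: wp_seq; apply: wp_skiple; rewrite !(BaseN N6 X6) // => hle.
      apply: fin => //; first by rewrite f6.
      exists r0, s0, b0'; rewrite !f6 // epb; split=> //.
      move=> r' s' b' + vb'; rewrite ltnS => hseen.
      have [/andP[/eqP-> /eqP->]|hne] := boolP ((s' == s) && (r' == r)).
        apply: le_trans (hopt _ vb'); by rewrite -epb -hX6.
      by apply: k7 => //; lia.
    apply: wp_conseq (leqnn _).
      apply: (@save_bestP r s b _ _
       (fun r' s' => (s' < s) && (r' < B szI) || (s' == s) && (r' < r.+1))) => //.
      move=> r' s' b' + vb'; rewrite ltnS hX6 => hseen.
      have [/andP[/eqP-> /eqP->]|hne] := boolP ((s' == s) && (r' == r)).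
        exact: hopt.
      rewrite -hX6; apply: le_trans (ltW hle) _; rewrite epb.
      by apply: k7 => //; lia.
    move=> N7 X7 [f7 h7 g7 best7]; apply: fin => //.
    * have [hN hX] := base6; split=> t ht; last by rewrite g7 ?hX.
      by rewrite f7 ?hN //; lia.
    * by move=> t ht; apply: h7; lia.
    * by rewrite f7 // f6.
  + move=> N5 X5 [base5 [es5 euq5 euc5 er5] best5].
    have [r0 [s0 [b0' [k1 [k2 k3 k4] k5 k6 k7]]]] := best5.
    apply: wp_opsI => //=.
    rewrite !(BaseN _ _ sj base5, BaseN _ _ cj base5, BaseN _ _ one base5,
      BaseN _ _ szJ base5) // wf_one // es5 euq5 euc5 addn1; split=> //.
    split=> //=; last first.
      exists r0, s0, b0'; split=> // r' s' b' h; apply: k7.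
      by move: h; lia.
    * by split=> //; nia.
    * split; last by have [] := base5.
      by move=> t ht; rewrite -(proj1 base5) //= !ifF //; apply/negbTE; lia.
move=> N5 X5 [base5 _ [r0 [s0 [b0' [k1 [k2 k3 k4] k5 k6 k7]]]]].
apply: wp_seq; apply: wp_opsI => //=.
rewrite k2 k3 k4 (BaseN _ _ zero base5) // wf_zero // !addn0.
set N6 := upd _ _ _.
have f6 : frameN 31 N5 N6 by do 3 apply: frameN_upd => //.
have c6 : ctx r0 s0 N6 X5.
  split=> //; last by have [] := base5.
  by move=> t ht; rewrite f6 ?(BaseN _ _ t base5) //; lia.
(* The rebuilt b is optimal for the recorded (r0, s0), so its cost is at most the recorded minimum
   even if it differs from the b found before. *)
apply: wp_conseq (leqnn _); first exact: eval_spec c6 k1.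
move=> N7 X7 [f7 g7 [b [hb hX7 hopt]]].
split; first by move=> t ht; rewrite f7 ?f6 -?(proj1 base5) //; lia.
exists r0, s0, b; split=> //.
- by split; rewrite f7.
- by move=> l /hb[].
- by move=> l /hb[].
move=> r' s' b' hr' hs' vb'; apply: le_trans (hopt _ k5) _; rewrite -k6.
by apply: k7 => //; rewrite hs'.
Qed.

Definition ones (a b : nat -> nat) : seq nat :=
  [seq B cb + i * B ci + a i * B cj - B qsize + 2 | i <- iota 0 (B szI)] ++
  [seq B db + b l * B dk + l * B dl - B qsize + 2 | l <- iota 0 (B szL)].

Definition out_end := B pbest - B qsize + 2.

(** The copy at [image] is complete, while the direct output is correct only from cell 64 on, beyond
    the registers. *)
Definition marked (s : seq nat) N :=
  forall t, t < out_end ->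
  N (B image + t) = (t \in s) /\ (64 <= t -> N t = (t \in s)).

Lemma eq_marked s1 s2 N : s1 =i s2 -> marked s1 N -> marked s2 N.
Proof. by move=> e h t /h; rewrite e. Qed.

Lemma marked_frame s N N' :
  (forall t, 64 <= t -> N' t = N t) -> marked s N -> marked s N'.
Proof.
move=> e h t ht; have [h1 h2] := h t ht; have hM := wf_image wfB.
by rewrite e; [split=> // h64; rewrite e ?h2 | lia].
Qed.

(** The target cell is below [image] and its copy lies between [image] and [array], so neither store
    hits a register, the other copy or the choices still to be read. *)
Lemma mark_spec s o N X : (forall t, t < 27 -> N t = B t) -> N tmp = o ->
  B qsize <= o < B pbest -> marked s N ->
  wp mark 6 (fun N' _ =>
    [/\ forall t, (t < 44) || (B array <= t) -> N' t = N t &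
        marked (o - B qsize + 2 :: s) N']) N X.
Proof.
move=> cN eo ho hs.
have hA := wf_array wfB; have hM := wf_image wfB.
have hE : out_end <= B pbest + 2 by rewrite /out_end; lia.
apply: (@wp_seq _ _ _ 2 4); apply: wp_opsI => //=.
rewrite eo !cN // wf_two //; set o' := o - _ + 2.
have ho' : 2 <= o' < out_end by rewrite /o' /out_end; lia.
apply: (@wp_seq _ _ _ 2 2).
suff fin N1 : (forall t, t < 44 -> N1 t = N t) -> N1 tmp = o' ->
   (forall t, 64 <= t -> t != o' -> N1 t = N t) -> (64 <= o' -> N1 o' = 1) ->
   wp (Ops [:: NAdd tmp tmp image; NStoreI tmp one]) 2 (fun N' _ =>
    [/\ forall t, (t < 44) || (B array <= t) -> N' t = N t &
        marked (o' :: s) N']) N1 X.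
  apply: wp_skiplt; rewrite /= cN // wf_nreg // => h.
    apply: fin => //; last by lia.
      by move=> t ht /=; rewrite !ifF //; apply/negbTE; lia.
    by move=> t ht1 ht2 /=; rewrite !ifF //; apply/negbTE; lia.
  apply: wp_opsI => //=; rewrite (cN one) // wf_one //; apply: fin => /=.
  - by move=> t ht; rewrite !ifF //; apply/negbTE; lia.
  - by rewrite ifF //; apply/negbTE; lia.
  - by move=> t ht1 ht2; rewrite !ifF //; apply/negbTE; lia.
  - by rewrite eqxx.
move=> h1 h2 h3 h4; apply: wp_opsI => //=.
rewrite h2 !h1 // !cN // wf_one //; split.
  move=> t ht /=; rewrite !ifF; try (apply/negbTE; lia).
  by case/orP: ht => ht; [exact: h1 | rewrite h3 //; lia].
move=> t ht; have [e1 e2] := hs t ht; rewrite inE /=; split.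
  case: eqP => [E|E]; first by rewrite (_ : t == o') //; lia.
  rewrite ifF; last by apply/negbTE; lia.
  rewrite h3; try lia.
  by rewrite e1 (_ : (t == o') = false) //; apply/negbTE; lia.
move=> h64; rewrite !ifF; try (apply/negbTE; lia).
have [E|ne] := eqVneq t o'; first by rewrite E h4 // -E.
by rewrite h3 // e2.
Qed.

(** Marks are added at the head while [iota] grows at its end; lists of marked cells matter only up
    to membership. *)
Lemma mem_map_iota (f : nat -> nat) n s :
  [seq f i | i <- iota 0 n.+1] ++ s =i f n :: [seq f i | i <- iota 0 n] ++ s.
Proof.
move=> x; rewrite -addn1 iotaD map_cat /= add0n -catA !(mem_cat, inE) /=.
by rewrite orbCA.
Qed.

(** The 0s of the output are never written: they are the initial contents of the cells from 64 up to
    [array]. *)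
Lemma output_spec r s b N X : (forall t, t < 27 -> N t = B t) ->
  N r_ = r -> N uc = s * B cj -> s < B szJ -> valid_b b ->
  (forall l, l < B szL -> N (B array + l) = B db + b l * B dk + l * B dl) ->
  (forall t, 64 <= t < B array -> N t = 0) ->
  wp output
    (1 + (B szL * (2 + (6 + 1)).+1 + (2 + B szI * (1 + (2 + (6 + 2))).+1)))
    (fun N' _ => N' image = B image /\ N' two = 2 /\
       marked (ones (threshold r s) b) N') N X.
Proof.
move=> cN er euc hs hb harr hz.
have hA := wf_array wfB; have hM := wf_image wfB.
have hE : out_end <= B pbest + 2 by rewrite /out_end; lia.
apply: wp_seq; apply: wp_opsI => //=; set N1 := upd _ _ _.
have f1 t : t != 34 -> N1 t = N t by move=> ht; rewrite /N1 /= ifF //; apply/negbTE.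
pose sd n := [seq B db + b l * B dk + l * B dl - B qsize + 2 | l <- iota 0 n].
pose sc n := [seq B cb + i * B ci + threshold r s i * B cj - B qsize + 2 | i <- iota 0 n].
pose Keep (N' : nat -> nat) :=
  forall t, (t < 34) || (B array <= t) -> N' t = N t.
have keepB N' t : Keep N' -> t < 27 -> N' t = B t.
  by move=> h ht; rewrite h ?cN //; lia.
apply: wp_seq; apply: (@wp_do _ (fun l N' _ => [/\ Keep N', N' l_ = l &
  marked (sd l) N'])); first exact: wf_L.
- split=> //; first by move=> t ht; apply: f1; lia.
  by move=> t ht; rewrite in_nil; split=> [|h]; rewrite f1 ?hz //; lia.
- move=> l N2 X2 hl [k2 el m2].
  apply: wp_seq; apply: wp_opsI => //=.
  rewrite el (keepB N2) //; set N3 := upd _ _ _.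
  have e3 : N3 tmp = B db + b l * B dk + l * B dl.
    by rewrite /N3 /= ifF ?(k2 (B array + l)) ?harr //; [lia | apply/negbTE; lia].
  have f3 t : t != 37 -> t != 44 -> N3 t = N2 t.
    by move=> h h'; rewrite /N3 /= !ifF //; apply/negbTE.
  have k3 : Keep N3 by move=> t ht; rewrite f3 ?k2 //; lia.
  apply: wp_seq; apply: wp_conseq (leqnn _).
    apply: (@mark_spec (sd l)) e3 _ _.
    + by move=> t; exact: keepB.
    + exact: wf_d (hb _ hl) hl.
    + by apply: marked_frame m2 => t ht; apply: f3; lia.
  move=> N4 X4 [f4 m4]; apply: wp_opsI => //=.
  rewrite !(f4 l_, f4 one, f4 szL, keepB _ one k3, keepB _ szL k3) // wf_one //.
  rewrite f3 // el addn1; split=> //; split=> //.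
    move=> t ht /=; rewrite ifF; last by apply/negbTE; lia.
    by rewrite f4 ?k3 //; lia.
  have m5 : marked (sd l.+1) N4.
    apply: eq_marked m4 => x; have := mem_map_iota
     (fun l => B db + b l * B dk + l * B dl - B qsize + 2) l [::] x.
    by rewrite !cats0.
  by apply: marked_frame m5 => t ht /=; rewrite ifF //; apply/negbTE; lia.
move=> N2 X2 [k2 _ m2].
apply: wp_seq; apply: wp_opsI => //=.
rewrite (keepB N2 cb) // (keepB N2 zero) // wf_zero // addn0.
set N3 := upd _ _ _.
have f3 t : t != 42 -> t != 43 -> N3 t = N2 t.
  by move=> h h'; rewrite /N3 /= !ifF //; apply/negbTE.
apply: (@wp_do _ (fun i N' _ => [/\ Keep N', N' i_ = i,
  N' ptr = B cb + i * B ci & marked (sc i ++ sd (B szL)) N'])); first exact: wf_I.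
- split=> //; first by move=> t ht; rewrite f3 ?k2 //; lia.
    by rewrite mul0n addn0.
  by apply: marked_frame m2 => t ht; apply: f3; lia.
- move=> i N4 X4 hi [k4 ei ep m4].
  apply: wp_seq; apply: wp_opsI => //=.
  rewrite ep (keepB N4 zero) // wf_zero // addn0; set N5 := upd _ _ _.
  have fin N6 : (forall t, t != 44 -> N6 t = N4 t) ->
    N6 tmp = B cb + i * B ci + threshold r s i * B cj ->
    wp (Seq mark (Ops [:: NAdd ptr ptr ci; NAdd i_ i_ one])) (6 + 2)
      (fun N' _ => [/\ Keep N', N' i_ = i.+1, N' ptr = B cb + i.+1 * B ci &
          marked (sc i.+1 ++ sd (B szL)) N'] /\ (N' i_ < N' szI) = (i.+1 < B szI))
      N6 X4.
    move=> f6 e6; apply: wp_seq; apply: wp_conseq (leqnn _).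
      apply: (@mark_spec (sc i ++ sd (B szL))) e6 _ _.
      + by move=> t ht; rewrite f6 ?(keepB N4 t k4 ht) //; lia.
      + exact: wf_c hi (threshold_lt _ _ hs).
      + by apply: marked_frame m4 => t ht; apply: f6; lia.
    move=> N7 X7 [f7 m7]; apply: wp_opsI => //=.
    rewrite !(f7 ptr, f7 i_, f7 one, f7 szI, f7 ci) //.
    rewrite !f6 // ep ei !(keepB N4) // wf_one // addn1; split=> //; split=> //.
    + move=> t ht /=; rewrite !ifF; try (apply/negbTE; lia).
      by rewrite f7 ?f6 ?k4 //; lia.
    + by rewrite /=; nia.
    have m8 : marked (sc i.+1 ++ sd (B szL)) N7.
      by apply: eq_marked m7 => x; rewrite [RHS]mem_map_iota.
    by apply: marked_frame m8 => t ht /=; rewrite !ifF //; apply/negbTE; lia.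
  apply: wp_seq; apply: wp_skiplt; rewrite /N5 /= ei k4 // er => h.
    apply: fin => [t ht /=|]; first by rewrite ifF //; apply/negbTE.
    by rewrite /threshold h /= addn0.
  apply: wp_opsI => //=; apply: fin => [t ht /=|/=].
    by rewrite !ifF //; apply/negbTE.
  by rewrite k4 // euc /threshold ltnNge h.
by move=> N4 X4 [k4 _ _ m4]; rewrite !(keepB N4) // wf_two //; split.
Qed.

(** Reads start at p >= 64 and writes stay below 64, so no cell is read after it has been
    overwritten. *)
Lemma reload_spec t n (p : nat) (Q : assertion R) N X :
  N 0 = p -> N 1 = 1 -> 2 <= t -> 64 <= p -> t + n <= 64 ->
  (forall N', (forall u, t <= u < t + n -> N' u = N (p + (u - t))) ->
     (forall u, 1 < u -> (u < t) || (t + n <= u) -> N' u = N u) -> Q N' X) ->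
  wp_ops (reload t n) Q N X.
Proof.
elim: n t p N => [|n IH] t p N e0 e1 ht hp htn hQ.
  by apply: hQ => // u; lia.
rewrite /=; apply: (IH t.+1 p.+1).
- by rewrite /= !ifF ?e0 ?e1 ?addn1 //; apply/negbTE; lia.
- by rewrite /= ifF ?e1 //; apply/negbTE; lia.
- by lia.
- by lia.
- by lia.
move=> N' h1 h2; apply: hQ.
  move=> u hu; have [->|ne] := eqVneq u t.
    by rewrite subnn addn0 h2 /= ?eqxx ?e0 //; try lia; rewrite ifF //; apply/negbTE; lia.
  rewrite h1 /= ?ifF; try (apply/negbTE; lia); last by lia.
  by congr (N _); lia.
move=> u hu1 hu2; rewrite h2 /= ?ifF //; try (apply/negbTE; lia); lia.
Qed.

Lemma size_restore n : size (restore n) = n.*2.+2.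
Proof. by rewrite /=; elim: n 2 => //= n IH t; have [->] := IH t.+1. Qed.

Lemma restore_spec n (Q : assertion R) N X :
  N two = 2 -> 62 <= N image -> n <= 62 ->
  (forall N', (forall t, 2 <= t < n + 2 -> N' t = N (N image + t)) ->
     (forall t, n + 2 <= t -> N' t = N t) -> Q N' X) ->
  wp_ops (restore n) Q N X.
Proof.
move=> e2 hM hn hQ /=; apply: (@reload_spec 2 n (N image + 2)) => //.
- by rewrite /= e2.
- by lia.
move=> N' h1 h2; apply: hQ => t ht.
  by rewrite h1 /= ?ifF; try (apply/negbTE; lia); [congr (N _)|]; lia.
by rewrite h2 /= ?ifF //; try (apply/negbTE); lia.
Qed.

Lemma main_spec N X : (forall t, t < 27 -> N t = B t) ->
  frameX (B pbest) X0 X -> (forall t, 64 <= t -> N t = 0) ->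
  wp main (tmain (B szI) (B szJ) (B szK) (B szL)) (fun N' _ =>
    exists r s b, [/\ s < B szJ, valid_b b,
      forall t, 2 <= t < out_end -> N' t = (t \in ones (threshold r s) b) &
      forall r' s' b', r' < B szI -> s' < B szJ -> valid_b b' ->
        (cost (threshold r s) b <= cost (threshold r' s') b')%R]) N X.
Proof.
move=> cN cX hz; have hM := wf_image wfB.
apply: wp_seq; apply: wp_conseq (leqnn _); first exact: search_spec.
move=> N1 X1 [f1 [r [s [b [hs [er euc] hb harr hopt]]]]].
have c1 t : t < 27 -> N1 t = B t by move=> ht; rewrite f1 ?cN ?ht.
apply: wp_seq; apply: wp_conseq (leqnn _).
  apply: output_spec c1 er euc hs hb harr _ => t ht.
  by rewrite f1 ?hz //; lia.
move=> N2 X2 [eM [e2 hm]]; apply: wp_opsI; last by rewrite size_restore.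
refine (restore_spec e2 _ (leqnn 62) _); first by rewrite eM; lia.
rewrite eM.
move=> N' h1 h2; exists r, s, b; split=> // t /andP[t2 tE].
have [m1 m2] := hm t tE.
have [h|h] := ltnP t 64.
  by rewrite h1 //; lia.
by rewrite h2 ?m2.
Qed.

End Routines.

(** * Loading the instance *)

Local Notation rawI := 45 (only parsing).
Local Notation rawJ := 46 (only parsing).
Local Notation rawK := 47 (only parsing).
Local Notation rawL := 48 (only parsing).
Local Notation rawKL := 49 (only parsing).
Local Notation rawJKL := 50 (only parsing).
Local Notation rawIJ := 51 (only parsing).
Local Notation rawdb := 52 (only parsing).
Local Notation cnt := 53 (only parsing).

(** Multiplication by repeated addition; as the loop body runs at least once, the factor in [b] must
    be positive. *)
Definition mul (d a b : nat) : cmd :=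
  Seq (Ops [:: NConst d 0; NConst cnt 0])
      (DoLt (Ops [:: NAdd d d a; NAdd cnt cnt one]) cnt b).

Definition setup : cmd :=
  Seq (Ops [:: NConst one 1; NConst two 2; NConst nreg 64])
  (Seq (mul rawKL rawK rawL)
  (Seq (mul rawJKL rawKL rawJ)
  (Seq (mul qsize rawJKL rawI)
  (Seq (mul rawIJ rawI rawJ)
       (Ops [:: NAdd rawdb qsize rawIJ; NAdd pbest rawdb rawKL;
                NAdd pval pbest one; NAdd pmin pval one; NAdd pw pmin one;
                NAdd image pbest nreg; NAdd array image image]))))).

Definition assign : seq instr :=
  [:: NAdd szI rawI zero; NAdd szJ rawJ zero; NAdd szK rawK zero;
      NAdd szL rawL zero; NAdd si rawJKL zero; NAdd sj rawKL zero;
      NAdd sk rawL zero; NAdd sl one zero; NAdd cb qsize zero;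
      NAdd ci rawJ zero; NAdd cj one zero; NAdd db rawdb zero;
      NAdd dk rawL zero; NAdd dl one zero].

(** The same search is run on the transposed data: the entry q i j k l is read as indexed by (l, k,
    j, i), and c and d change places. *)
Definition assign_swapped : seq instr :=
  [:: NAdd szI rawL zero; NAdd szJ rawK zero; NAdd szK rawJ zero;
      NAdd szL rawI zero; NAdd si one zero; NAdd sj rawL zero;
      NAdd sk rawKL zero; NAdd sl rawJKL zero; NAdd cb rawdb zero;
      NAdd ci one zero; NAdd cj rawL zero; NAdd db qsize zero;
      NAdd dk one zero; NAdd dl rawJ zero].

Definition tmul (b : nat) := 2 + b * 3.
Definition tsetup (I J L : nat) :=
  3 + (tmul L + (tmul J + (tmul I + (tmul J + 7)))).

(** * Address computation and the two role assignments *)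

Section Prologue.

Variable R : realType.

Implicit Types (N : nat -> nat) (X : nat -> R).

Lemma mul_spec d a b N X (Q : assertion R) :
  d != cnt -> a != d -> b != d -> a != cnt -> b != cnt -> d != one ->
  N one = 1 -> 0 < N b ->
  (forall N', N' d = N a * N b ->
     (forall t, t != d -> t != cnt -> N' t = N t) -> Q N' X) ->
  wp (mul d a b) (tmul (N b)) Q N X.
Proof.
move=> dc ad bd ac bc d1 e1 hb hQ.
apply: wp_seq; apply: wp_opsI => //=.
apply: (@wp_do _ (fun k N' X' => [/\ X' = X, N' cnt = k, N' d = N a * k &
   forall t, t != d -> t != cnt -> N' t = N t])) => //=.
- split=> //; first by rewrite (negbTE dc) eqxx muln0.
  by move=> t h1 h2; rewrite (negbTE h1) (negbTE h2).
- move=> k N1 X1 hk [-> ec ed f]; apply: wp_opsI => //=.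
  have d3 : (one == d) = false by rewrite eq_sym (negbTE d1).
  have dc' : (cnt == d) = false by rewrite eq_sym (negbTE dc).
  rewrite (negbTE dc) (negbTE bc) (negbTE bd) d3 dc' eqxx ec ed !(f a, f b, f one) ?d3 // e1.
  rewrite addn1 mulnS addnC; split=> //; split=> // t h1 h2.
  by rewrite (negbTE h1) (negbTE h2) f.
by move=> N1 X1 [-> _ ed f]; apply: hQ.
Qed.

Definition prepared (I J K L : nat) N : Prop :=
  [/\ [/\ N zero = 0, N one = 1, N two = 2 & N nreg = 64],
      [/\ N rawI = I, N rawJ = J, N rawK = K & N rawL = L],
      [/\ N rawKL = K * L, N rawJKL = J * K * L, N qsize = I * J * K * L &
          N rawdb = I * J * K * L + I * J],
      [/\ N pbest = I * J * K * L + I * J + K * L, N pval = N pbest + 1,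
          N pmin = N pbest + 2 & N pw = N pbest + 3] &
      N image = N pbest + 64 /\ N array = N image + N image].

Lemma setup_spec I J K L N X : 0 < I -> 0 < J -> 0 < L ->
  [/\ N rawI = I, N rawJ = J, N rawK = K & N rawL = L] -> N zero = 0 ->
  wp setup (tsetup I J L) (fun N' X' => [/\ X' = X, prepared I J K L N',
     N' 0 = N 0, N' 1 = N 1 & forall t, 64 <= t -> N' t = N t]) N X.
Proof.
move=> I0 J0 L0 [eI eJ eK eL] e0.
apply: wp_seq; apply: wp_opsI => //=; set N1 := upd _ _ _.
have f1 t : t \notin [:: 3; 4; 5] -> N1 t = N t.
  by rewrite !inE !negb_or => /and3P[h1 h2 h3]; rewrite /N1 /= !ifF //; apply/negbTE.
have L1 : N1 rawL = L by rewrite f1.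
apply: wp_seq; rewrite -{1}L1; apply: mul_spec; rewrite ?L1 //.
move=> N2; rewrite (f1 rawK) // eK => e2 f2.
have J2 : N2 rawJ = J by rewrite f2 ?f1.
have o2 : N2 one = 1 by rewrite f2.
apply: wp_seq; rewrite -{1}J2; apply: mul_spec; rewrite ?J2 //.
move=> N3; rewrite e2 => e3 f3.
have I3 : N3 rawI = I by rewrite f3 ?f2 ?f1.
have o3 : N3 one = 1 by rewrite f3.
apply: wp_seq; rewrite -{1}I3; apply: mul_spec; rewrite ?I3 //.
move=> N4; rewrite e3 => e4 f4.
have I4 : N4 rawI = I by rewrite f4.
have J4 : N4 rawJ = J by rewrite f4 ?f3.
have o4 : N4 one = 1 by rewrite f4.
apply: wp_seq; rewrite -{1}J4; apply: mul_spec; rewrite ?J4 //.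
move=> N5; rewrite I4 => e5 f5.
apply: wp_opsI => //=.
have e5' : N5 qsize = I * J * K * L by rewrite f5 // e4; nia.
have e2' : N5 rawKL = K * L by rewrite f5 // f4 // f3 // e2.
have e1' : N5 one = 1 by rewrite f5 // f4 // f3 // f2.
have en : N5 nreg = 64 by rewrite f5 // f4 // f3 // f2.
rewrite e5 e5' e2' e1' en; split=> //.
- split; split=> //=; rewrite ?e1' ?en ?e5' ?e2' //; try lia.
  + by rewrite f5 // f4 // f3 // f2 // f1.
  + by rewrite f5 // f4 // f3 // f2 // f1.
  + by rewrite f5 // f4 // f3 // f2 // f1.
  + by rewrite f5 // f4 // f3 // f2 // f1.
  + by rewrite f5 // f4 // f3 // f2 // f1.
  + by rewrite f5 // f4 // f3 // f2 // f1.
  + by rewrite f5 // f4 // e3; nia.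
- by rewrite /= f5 // f4 // f3 // f2 // f1.
- by rewrite /= f5 // f4 // f3 // f2 // f1.
- move=> t ht; rewrite /= !ifF; try (apply/negbTE; lia).
  rewrite f5 ?f4 ?f3 ?f2 ?f1 ?inE //; try lia.
Qed.

Lemma ltn_pair i I j J : i < I -> j < J -> i * J + j < I * J.
Proof. by move=> hi hj; nia. Qed.

Definition qaddr (J K L i j k l : nat) := ((i * J + j) * K + k) * L + l.

Lemma qaddr_lt I J K L i j k l : i < I -> j < J -> k < K -> l < L ->
  qaddr J K L i j k l < I * J * K * L.
Proof. by move=> *; do 3 apply: ltn_pair => //. Qed.

(** The cost in the original layout, symmetric in the roles of the two maps; both assignments of
    strides are reduced to it. *)
Definition objective (I J K L : nat) X (a b : nat -> nat) : R :=
  (\sum_(i < I) \sum_(l < L) X (qaddr J K L i (a i) (b l) l) +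
   \sum_(i < I) X (I * J * K * L + (i * J + a i))%N +
   \sum_(l < L) X (I * J * K * L + I * J + (b l * L + l))%N)%R.

Definition out_ones (I J L : nat) (a b : nat -> nat) : seq nat :=
  [seq 2 + (i * J + a i) | i <- iota 0 I] ++
  [seq 2 + (I * J + (b l * L + l)) | l <- iota 0 L].

Definition outputs (I J K L : nat) (a b : nat -> nat) N : Prop :=
  forall t, 2 <= t < 2 + I * J + K * L -> N t = (t \in out_ones I J L a b).

Definition into (L K : nat) (b : nat -> nat) : Prop := forall l, l < L -> b l < K.

Definition normal_optimum I J K L X N : Prop :=
  exists r s b, [/\ s < J, into L K b, outputs I J K L (threshold r s) b N &
    forall r' s' b', r' < I -> s' < J -> into L K b' ->
      (objective I J K L X (threshold r s) b <=
       objective I J K L X (threshold r' s') b')%R].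

Definition swapped_optimum I J K L X N : Prop :=
  exists r s a, [/\ s < K, into I J a, outputs I J K L a (threshold r s) N &
    forall r' s' a', r' < L -> s' < K -> into I J a' ->
      (objective I J K L X a (threshold r s) <=
       objective I J K L X a' (threshold r' s'))%R].

Definition assigned (I J K L : nat) N N' : Prop :=
  [/\ [/\ N' szI = I, N' szJ = J, N' szK = K & N' szL = L],
      [/\ N' si = J * K * L, N' sj = K * L, N' sk = L & N' sl = 1],
      [/\ N' cb = I * J * K * L, N' ci = J & N' cj = 1],
      [/\ N' db = I * J * K * L + I * J, N' dk = L & N' dl = 1] &
      forall t, (t < 12) || (25 < t) -> N' t = N t].

Definition assigned_swapped (I J K L : nat) N N' : Prop :=
  [/\ [/\ N' szI = L, N' szJ = K, N' szK = J & N' szL = I],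
      [/\ N' si = 1, N' sj = L, N' sk = K * L & N' sl = J * K * L],
      [/\ N' cb = I * J * K * L + I * J, N' ci = 1 & N' cj = L],
      [/\ N' db = I * J * K * L, N' dk = 1 & N' dl = J] &
      forall t, (t < 12) || (25 < t) -> N' t = N t].

Lemma wp_assign I J K L N X (Q : assertion R) : prepared I J K L N ->
  (forall N', assigned I J K L N N' -> Q N' X) -> wp (Ops assign) 14 Q N X.
Proof.
move=> [[n2 n3 n4 n5] [n45 n46 n47 n48] [n49 n50 n6 n52] _ _] hQ.
apply: wp_opsI => //=; apply: hQ.
rewrite n2 n3 n6 n45 n46 n47 n48 n49 n50 n52 !addn0; split=> //.
by move=> t ht; rewrite /= !ifF //; apply/negbTE; lia.
Qed.

Lemma wp_assign_swapped I J K L N X (Q : assertion R) : prepared I J K L N ->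
  (forall N', assigned_swapped I J K L N N' -> Q N' X) -> wp (Ops assign_swapped) 14 Q N X.
Proof.
move=> [[n2 n3 n4 n5] [n45 n46 n47 n48] [n49 n50 n6 n52] _ _] hQ.
apply: wp_opsI => //=; apply: hQ.
rewrite n2 n3 n6 n45 n46 n47 n48 n49 n50 n52 !addn0; split=> //.
by move=> t ht; rewrite /= !ifF //; apply/negbTE; lia.
Qed.

Lemma main_normal I J K L N N1 X : 0 < I -> 0 < J -> 0 < K -> 0 < L ->
  prepared I J K L N -> assigned I J K L N N1 -> (forall t, 64 <= t -> N1 t = 0) ->
  wp main (tmain I J K L) (fun N' _ => normal_optimum I J K L X N') N1 X.
Proof.
move=> I0 J0 K0 L0.
move=> [[n2 n3 n4 n5] _ [_ _ n6 _] [n8 n9 n10 n11] [n7 n26]].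
move=> [[eI eJ eK eL] [ei ej ek el] [ec eci ecj] [ed edk edl] f1] hz.
have wf1 : wf N1.
  split; rewrite ?eI ?eJ ?eK ?eL ?ei ?ej ?ek ?el ?ec ?eci ?ecj ?ed ?edk ?edl //
   ?f1 // ?n26 ?n7 ?n9 ?n10 ?n11 ?n8 ?n6 //.
  - move=> i j k l hi hj hk hl; have := qaddr_lt hi hj hk hl.
    by rewrite /qaddr; lia.
  - by move=> i j hi hj; have := ltn_pair hi hj; lia.
  - by move=> k l hk hl; have := ltn_pair hk hl; lia.
have eP : out_end N1 = 2 + I * J + K * L by rewrite /out_end !f1 // n8 n6; lia.
have costE a b : cost N1 X a b = objective I J K L X a b.
  rewrite /cost /objective /weight eI eL ei ej ek el ec eci ecj ed edk edl.
  rewrite big_split /= addrA [LHS]addrC addrA exchange_big /=.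
  congr (_ + _ + _)%R.
  - by apply: eq_bigr => i _; apply: eq_bigr => l _; congr X; rewrite /qaddr; lia.
  - by apply: eq_bigr => i _; congr X; lia.
  - by apply: eq_bigr => l _; congr X; lia.
have onesE a b : ones N1 a b = out_ones I J L a b.
  rewrite /ones /out_ones eI eL ec eci ecj ed edk edl f1 // n6.
  by congr (_ ++ _); apply: eq_map => i; lia.
have h := main_spec wf1 (X0 := X) (N := N1) (fun _ _ => erefl) (fun _ _ => erefl) hz.
rewrite eI eJ eK eL in h; apply: wp_conseq h _ (leqnn _).
move=> N' _ [r [s [b [hs hb hN hopt]]]]; exists r, s, b.
rewrite /valid_b eK eL in hb.
split=> //; first by move=> t ht; rewrite hN ?onesE // eP.
move=> r' s' b' hr' hs' hb'; rewrite -!costE; apply: hopt; rewrite ?eI ?eJ //.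
by rewrite /valid_b eK eL.
Qed.

Lemma main_swapped I J K L N N1 X : 0 < I -> 0 < J -> 0 < K -> 0 < L ->
  prepared I J K L N -> assigned_swapped I J K L N N1 ->
  (forall t, 64 <= t -> N1 t = 0) ->
  wp main (tmain L K J I) (fun N' _ => swapped_optimum I J K L X N') N1 X.
Proof.
move=> I0 J0 K0 L0.
move=> [[n2 n3 n4 n5] _ [_ _ n6 _] [n8 n9 n10 n11] [n7 n26]].
move=> [[eI eJ eK eL] [ei ej ek el] [ec eci ecj] [ed edk edl] f1] hz.
have wf1 : wf N1.
  split; rewrite ?eI ?eJ ?eK ?eL ?ei ?ej ?ek ?el ?ec ?eci ?ecj ?ed ?edk ?edl //
   ?f1 // ?n26 ?n7 ?n9 ?n10 ?n11 ?n8 ?n6 //.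
  - move=> l k j i hl hk hj hi; have := qaddr_lt hi hj hk hl.
    by rewrite /qaddr; lia.
  - by move=> l k hl hk; have := ltn_pair hk hl; lia.
  - by move=> j i hj hi; have := ltn_pair hi hj; lia.
have eP : out_end N1 = 2 + I * J + K * L by rewrite /out_end !f1 // n8 n6; lia.
have costE a b : cost N1 X b a = objective I J K L X a b.
  rewrite /cost /objective /weight eI eL ei ej ek el ec eci ecj ed edk edl.
  rewrite big_split /= [LHS]addrC.
  rewrite [(\sum_(i < I) X _ + _)%R]addrC; congr (_ + _ + _)%R.
  - by apply: eq_bigr => i _; apply: eq_bigr => l _; congr X; rewrite /qaddr; lia.
  - by apply: eq_bigr => i _; congr X; lia.
  - by apply: eq_bigr => l _; congr X; lia.
have onesE a b : ones N1 b a =i out_ones I J L a b.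
  move=> x; rewrite /ones /out_ones eI eL ec eci ecj ed edk edl f1 // n6.
  rewrite !mem_cat orbC.
  by congr (_ || _); congr (x \in _); apply: eq_map => i; lia.
have h := main_spec wf1 (X0 := X) (N := N1) (fun _ _ => erefl) (fun _ _ => erefl) hz.
rewrite eI eJ eK eL in h; apply: wp_conseq h _ (leqnn _).
move=> N' _ [r [s [a [hs ha hN hopt]]]]; exists r, s, a.
rewrite /valid_b eK eL in ha.
split=> //; first by move=> t ht; rewrite hN ?onesE // eP.
move=> r' s' a' hr' hs' ha'; rewrite -!costE; apply: hopt; rewrite ?eI ?eJ //.
by rewrite /valid_b eK eL.
Qed.

End Prologue.

(** * Counting dominated solutions *)

Section Domination.

Variable R : realType.
Local Open Scope ring_scope.

Definition assignment_cost (I L A B : finType) (q : I -> A -> B -> L -> R)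
    (c : I -> A -> R) (d : B -> L -> R) (a : {ffun I -> A}) (b : {ffun L -> B}) : R :=
  \sum_i \sum_l q i (a i) (b l) l + \sum_i c i (a i) + \sum_l d (b l) l.

(** * Averaging over translation classes *)

Section Averaging.

Variables (I L : finType) (A B : finZmodType).
Variables (q : I -> A -> B -> L -> R) (c : I -> A -> R) (d : B -> L -> R).
Local Notation F := (assignment_cost q c d).

Definition shift (T : finType) (V : finZmodType) (a : {ffun T -> V}) (s : V) :
  {ffun T -> V} := [ffun i => a i + s].

(** For fixed i and l, the pair (a i + s, b l + t) runs once through A * B as s and t vary. The
    right-hand side is thus free of a and b; the linear terms are repeated once for each value of
    the shift they do not involve. *)
Lemma sum_shift (a : {ffun I -> A}) (b : {ffun L -> B}) :
  \sum_s \sum_t F (shift a s) (shift b t) =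
  \sum_i \sum_l \sum_s \sum_t q i s t l +
  (\sum_i \sum_s c i s) *+ #|B| + (\sum_l \sum_t d t l) *+ #|A|.
Proof.
have reA (v : A) (h : A -> R) : \sum_s h (v + s) = \sum_s h s.
  by rewrite [RHS](reindex_inj (addrI v)).
have reB (v : B) (h : B -> R) : \sum_s h (v + s) = \sum_s h s.
  by rewrite [RHS](reindex_inj (addrI v)).
rewrite /assignment_cost; under eq_bigr => s _ do rewrite !big_split /=.
rewrite !big_split /=; congr (_ + _ + _).
- under eq_bigr => s _ do rewrite exchange_big /=.
  rewrite exchange_big; apply: eq_bigr => i _ /=.
  under eq_bigr => s _ do rewrite exchange_big /=.
  rewrite exchange_big; apply: eq_bigr => l _ /=.
  rewrite -(reA (a i) (fun s => \sum_t q i s t l)); apply: eq_bigr => s _.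
  rewrite -(reB (b l) (fun t => q i _ t l)); apply: eq_bigr => t _.
  by rewrite !ffunE.
- under eq_bigr => s _ do rewrite sumr_const.
  rewrite sumrMnl; congr (_ *+ _); rewrite exchange_big; apply: eq_bigr => i _ /=.
  rewrite -[RHS](reA (a i)); apply: eq_bigr => s _; by rewrite !ffunE.
rewrite sumr_const; congr (_ *+ _); rewrite exchange_big; apply: eq_bigr => l _ /=.
by rewrite -[RHS](reB (b l)); apply: eq_bigr => s _; rewrite !ffunE.
Qed.

(** If every member of some class cost less than v, the sum over that class would be smaller than
    over the class of constant pairs, which [sum_shift] forbids. *)
Lemma averaging (v : R) :
  (forall s t, v <= F [ffun=> s] [ffun=> t]) ->
  (#|A| ^ #|I| * #|B| ^ #|L| <=
   #|[set p : {ffun I -> A} * {ffun L -> B} | (v <= F p.1 p.2)%R]| * (#|A| * #|B|))%N.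
Proof.
move=> hv; set G := [set p | _].
have ex (p : {ffun I -> A} * {ffun L -> B}) :
    exists w : A * B, (shift p.1 w.1, shift p.2 w.2) \in G.
  apply/existsP; apply: contraT; rewrite negb_exists => /forallP hn.
  suff: \sum_s \sum_t F (shift p.1 s) (shift p.2 t) <
        \sum_s \sum_t F (shift [ffun=> 0] s) (shift [ffun=> 0] t).
    by rewrite !sum_shift ltxx.
  rewrite !pair_bigA /=; apply: ltr_sum.
    by apply/hasP; exists (0, 0); rewrite ?mem_index_enum.
  move=> [s t] _ /=; have := hn (s, t); rewrite inE /= -ltNge => /lt_le_trans; apply.
  have -> : shift [ffun=> 0] s = [ffun=> s] :> {ffun I -> A}.
    by apply/ffunP => i; rewrite !ffunE add0r.
  have -> : shift [ffun=> 0] t = [ffun=> t] :> {ffun L -> B}.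
    by apply/ffunP => i; rewrite !ffunE add0r.
  exact: hv.
(* Undoing the shift maps the product of G with the set of shifts onto all pairs of maps, whence the
   product on the right-hand side. *)
pose back (u : ({ffun I -> A} * {ffun L -> B}) * (A * B)) :=
  (shift u.1.1 (- u.2.1), shift u.1.2 (- u.2.2)).
rewrite -!card_ffun -!card_prod -[#|{: A * B}|]cardsT -cardsX -[leqLHS]cardsT.
apply: leq_trans (leq_imset_card back _); apply: subset_leq_card.
apply/subsetP => -[a b] _; have [[s t] h] := ex (a, b).
apply/imsetP; exists ((shift a s, shift b t), (s, t)).
  by rewrite inE /= h inE.
by rewrite /back /=; congr (_, _); apply/ffunP => i; rewrite !ffunE addrK.
Qed.

End Averaging.

Definition threshold_ffun (I J : nat) (r s : nat) : {ffun 'I_I -> 'I_J.+1} :=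
  [ffun i : 'I_I => inord (threshold r s i)].

(** Restricted to nonzero s, the threshold maps are pairwise distinct: since r < I, the value at the
    last index is s, and two values of r differ at the smaller one, where one map is 0 and the other
    is not. *)
Lemma threshold_card (I J : nat) (T : finType)
    (G : {set {ffun 'I_I -> 'I_J} * T}) : (0 < J)%N ->
  (forall r s b, (r < I)%N -> forall a : {ffun 'I_I -> 'I_J}, (s < J)%N ->
    (forall i : 'I_I, a i = threshold r s i :> nat) -> (a, b) \in G) ->
  (I * (J - 1) * #|T| <= #|G|)%N.
Proof.
case: J G => // J G _ hG; rewrite subn1 /=.
case: I G hG => [|I] G hG; first by rewrite !mul0n.
have thrE (r : 'I_I.+1) (s : 'I_J) (i : 'I_I.+1) :
    threshold_ffun I.+1 J r s.+1 i = threshold r s.+1 i :> nat.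
  by rewrite ffunE inordK // /threshold; case: ifP => // _; rewrite ltnS.
pose h (u : 'I_I.+1 * 'I_J * T) := (threshold_ffun I.+1 J u.1.1 u.1.2.+1, u.2).
have hinj : injective h.
  move=> [[r s] b] [[r' s'] b'] [] /ffunP e ->.
  have {}e (i : 'I_I.+1) : threshold r s.+1 i = threshold r' s'.+1 i :> nat.
    by rewrite -!thrE /= e.
  have es : s = s'.
    apply: val_inj; have := e ord_max.
    have nr (u : 'I_I.+1) : (I < u)%N = false by rewrite ltnNge -ltnS ltn_ord.
    by rewrite /threshold /= !nr => -[].
  have er : r = r'.
    apply: val_inj; apply/eqP; rewrite eqn_leq; apply/andP; split.
      by rewrite leqNgt; apply/negP => lt; have := e r'; rewrite /threshold lt ltnn.
    by rewrite leqNgt; apply/negP => lt; have := e r; rewrite /threshold lt ltnn.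
  by rewrite es er.
rewrite -[X in (X * J)%N]card_ord -[X in (_ * X * _)%N](card_ord J) -!card_prod.
rewrite -[leqLHS](card_imset predT hinj); apply: subset_leq_card.
apply/subsetP => _ /imsetP[[[r s] b] _ ->]; apply: (hG r s.+1) => //.
by rewrite ltnS.
Qed.

(** * Dominated pairs of maps and their 0-1 matrices *)

Section Counting.

Variables (I J K L : nat).
Variables (q : nat -> nat -> nat -> nat -> R) (c d : nat -> nat -> R).

Definition fcost (a : {ffun 'I_I -> 'I_J}) (b : {ffun 'I_L -> 'I_K}) : R :=
  assignment_cost (fun (i : 'I_I) (j : 'I_J) (k : 'I_K) (l : 'I_L) => q i j k l)
    (fun i j => c i j) (fun k l => d k l) a b.

Definition dominated (v : R) := [set p | v <= fcost p.1 p.2].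

Lemma averaging_ord v : (0 < J)%N -> (0 < K)%N ->
  (forall s t, v <= fcost [ffun=> s] [ffun=> t]) ->
  (J ^ I * K ^ L <= #|dominated v| * (J * K))%N.
Proof.
(* Successor sizes give the ordinals their cyclic group structure. *)
rewrite /dominated /fcost; case: J => // J' _; case: K => // K' _ hv.
by have := averaging hv; rewrite !card_ord.
Qed.

Lemma count_normal v : (0 < I)%N -> (0 < J)%N -> (0 < K)%N ->
  (forall (a : {ffun 'I_I -> 'I_J}) (b : {ffun 'I_L -> 'I_K}) r s,
    (r < I)%N -> (s < J)%N ->
    (forall i : 'I_I, a i = threshold r s i :> nat) -> v <= fcost a b) ->
  (J ^ I * K ^ L <= #|dominated v| * (J * K))%N /\
  (I * (J - 1) * K ^ L <= #|dominated v|)%N.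
Proof.
move=> I0 J0 K0 hv; split.
  (* A constant map is the threshold map with r = 0. *)
  apply: averaging_ord => // s t; apply: (hv _ _ 0 s) => // i.
  by rewrite ffunE.
have -> : (K ^ L = #|{ffun 'I_L -> 'I_K}|)%N by rewrite card_ffun !card_ord.
apply: threshold_card => // r s b hr a hs ha; rewrite inE.
exact: hv hr hs ha.
Qed.

Lemma count_swapped v : (0 < J)%N -> (0 < K)%N -> (0 < L)%N ->
  (forall (a : {ffun 'I_I -> 'I_J}) (b : {ffun 'I_L -> 'I_K}) r s,
    (r < L)%N -> (s < K)%N ->
    (forall l : 'I_L, b l = threshold r s l :> nat) -> v <= fcost a b) ->
  (J ^ I * K ^ L <= #|dominated v| * (J * K))%N /\
  (L * (K - 1) * J ^ I <= #|dominated v|)%N.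
Proof.
move=> J0 K0 L0 hv; split.
  apply: averaging_ord => // s t; apply: (hv _ _ 0 t) => // i.
  by rewrite ffunE.
have -> : (J ^ I = #|{ffun 'I_I -> 'I_J}|)%N by rewrite card_ffun !card_ord.
pose sw (p : {ffun 'I_I -> 'I_J} * {ffun 'I_L -> 'I_K}) := (p.2, p.1).
have sw_inj : injective sw by move=> [? ?] [? ?] [-> ->].
rewrite -(card_imset _ sw_inj).
apply: threshold_card => // r s a hr b hs hb.
apply/imsetP; exists (a, b) => //; rewrite inE; exact: hv hr hs hb.
Qed.

Definition row_choice (a : {ffun 'I_I -> 'I_J}) : 'M[bool]_(I, J) :=
  \matrix_(i, j) (a i == j).
Definition col_choice (b : {ffun 'I_L -> 'I_K}) : 'M[bool]_(K, L) :=
  \matrix_(k, l) (b l == k).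

Definition feasible_mx (x : 'M[bool]_(I, J)) (y : 'M[bool]_(K, L)) : bool :=
  [forall i : 'I_I, (\sum_(j < J) (x i j : nat))%N == 1%N] &&
  [forall l : 'I_L, (\sum_(k < K) (y k l : nat))%N == 1%N].

Definition fmx (x : 'M[bool]_(I, J)) (y : 'M[bool]_(K, L)) : R :=
  \sum_(i < I) \sum_(j < J) \sum_(k < K) \sum_(l < L)
      q i j k l * (x i j)%:R * (y k l)%:R
  + \sum_(i < I) \sum_(j < J) c i j * (x i j)%:R
  + \sum_(k < K) \sum_(l < L) d k l * (y k l)%:R.

Lemma feasible_choice a b : feasible_mx (row_choice a) (col_choice b).
Proof.
apply/andP; split; apply/forallP => i; apply/eqP.
  rewrite (bigD1 (a i)) //= mxE eqxx big1 // => j hj.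
  by rewrite mxE eq_sym (negbTE hj).
rewrite (bigD1 (b i)) //= mxE eqxx big1 // => j hj.
by rewrite mxE eq_sym (negbTE hj).
Qed.

Lemma sum_pick (T : finType) (t : T) (h : T -> R) :
  \sum_s h s * (t == s)%:R = h t.
Proof.
rewrite (bigD1 t) //= eqxx mulr1 big1 ?addr0 // => s hs.
by rewrite eq_sym (negbTE hs) mulr0.
Qed.

(** Row i of the first matrix has its only 1 in column a i and column l of the second in row b l, so
    the sums over j and k collapse by [sum_pick]. *)
Lemma fmx_choice a b : fmx (row_choice a) (col_choice b) = fcost a b.
Proof.
rewrite /fmx /fcost /assignment_cost; congr (_ + _ + _).
- apply: eq_bigr => i _; rewrite -(sum_pick (a i) (fun j => \sum_l q i j (b l) l)).
  apply: eq_bigr => j _; rewrite exchange_big mulr_suml; apply: eq_bigr => l _ /=.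
  rewrite -(sum_pick (b l) (fun k => q i j k l)) mulr_suml; apply: eq_bigr => k _.
  by rewrite !mxE mulrAC.
- apply: eq_bigr => i _; rewrite -(sum_pick (a i) (fun j => c i j)); apply: eq_bigr => j _.
  by rewrite mxE.
- rewrite exchange_big; apply: eq_bigr => l _; rewrite -(sum_pick (b l) (fun k => d k l)).
  by apply: eq_bigr => k _; rewrite mxE.
Qed.

Lemma row_choice_inj : injective row_choice.
Proof.
move=> a a' /matrixP e; apply/ffunP => i; have := e i (a i).
by rewrite !mxE eqxx => /esym/eqP.
Qed.

Lemma col_choice_inj : injective col_choice.
Proof.
move=> a a' /matrixP e; apply/ffunP => i; have := e (a i) i.
by rewrite !mxE eqxx => /esym/eqP.
Qed.

Lemma dominated_card v : (#|dominated v| <=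
  #|[set p : 'M[bool]_(I, J) * 'M[bool]_(K, L) |
     feasible_mx p.1 p.2 && (v <= fmx p.1 p.2)%R]|)%N.
Proof.
pose h p := (row_choice p.1, col_choice p.2).
have h_inj : injective h.
  by move=> [a b] [a' b'] [/row_choice_inj-> /col_choice_inj->].
rewrite -(card_imset _ h_inj); apply: subset_leq_card.
apply/subsetP => _ /imsetP[[a b] + ->]; rewrite !inE /= => hv.
by rewrite feasible_choice fmx_choice.
Qed.

Definition stored (X : nat -> R) : Prop :=
  [/\ forall i j k l, (i < I)%N -> (j < J)%N -> (k < K)%N -> (l < L)%N ->
        X (qaddr J K L i j k l) = q i j k l,
      forall i j, (i < I)%N -> (j < J)%N ->
        X (I * J * K * L + (i * J + j))%N = c i j &
      forall k l, (k < K)%N -> (l < L)%N ->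
        X (I * J * K * L + I * J + (k * L + l))%N = d k l].

Lemma objectiveE X (a : {ffun 'I_I -> 'I_J}) (b : {ffun 'I_L -> 'I_K})
    (a' b' : nat -> nat) :
  stored X -> (forall i : 'I_I, a i = a' i :> nat) ->
  (forall l : 'I_L, b l = b' l :> nat) ->
  objective I J K L X a' b' = fcost a b.
Proof.
move=> [hq hc hd] ha hb; rewrite /objective /fcost /assignment_cost.
congr (_ + _ + _).
- by apply: eq_bigr => i _; apply: eq_bigr => l _; rewrite -ha -hb hq.
- by apply: eq_bigr => i _; rewrite -ha hc.
- by apply: eq_bigr => l _; rewrite -hb hd.
Qed.

End Counting.

Lemma into_ffun (I J : nat) (a : nat -> nat) : into I J a ->
  exists a0 : {ffun 'I_I -> 'I_J}, forall i : 'I_I, a0 i = a i :> nat.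
Proof.
move=> h; exists [ffun i : 'I_I => Ordinal (h i (ltn_ord i))] => i.
by rewrite ffunE.
Qed.

Lemma ffun_into (I J : nat) (a : {ffun 'I_I -> 'I_J}) :
  exists2 a', into I J a' & forall i : 'I_I, a i = a' i :> nat.
Proof.
(* The value 0 outside the range is a default; [into] speaks of indices below I only. *)
exists (fun i => if insub i is Some i' then a i' : nat else 0%N).
  by move=> i hi /=; rewrite insubT.
by move=> i; rewrite valK.
Qed.

(** The ones of y start at cell 2 + I J, beyond this cell. Among the ones of x, division by J
    recovers the row, as both j and a i' are below J. *)
Lemma outputs_row (I J K L : nat) (a b : nat -> nat) (a0 : {ffun 'I_I -> 'I_J}) N
    (i : 'I_I) (j : 'I_J) :
  outputs I J K L a b N -> into L K b -> (forall i : 'I_I, a0 i = a i :> nat) ->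
  N (2 + i * J + j)%N = (a0 i == j) :> nat.
Proof.
move=> h hb ha; have hij := ltn_pair (ltn_ord i) (ltn_ord j).
rewrite h; last lia; congr nat_of_bool; rewrite mem_cat.
have -> : ((2 + i * J + j)%N \in
    [seq 2 + (I * J + (b l * L + l)) | l <- iota 0 L]) = false.
  by apply/negbTE/mapP => -[l _]; lia.
rewrite orbF; apply/mapP/eqP => [[i']|<-]; last first.
  by exists (val i); rewrite ?mem_iota ?ltn_ord //= -ha addnA.
rewrite mem_iota add0n => /= hi' e.
have hj : (j < J)%N by [].
have ha' : (a i' < J)%N by rewrite -(ha (Ordinal hi')).
have {}e : (i * J + j = i' * J + a i')%N by lia.
have J0 : (0 < J)%N by exact: leq_ltn_trans hj.
have ei : i' = i.
  have := congr1 (fun x => x %/ J)%N e.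
  by rewrite !divnMDl // !divn_small // !addn0.
by apply: val_inj; rewrite /= ha; move: e; rewrite ei => /addnI.
Qed.

(** The range condition on a keeps the ones of x below cell 2 + I J. Among the ones of y, the
    remainder modulo L recovers the column. *)
Lemma outputs_col (I J K L : nat) (a b : nat -> nat) (b0 : {ffun 'I_L -> 'I_K}) N
    (k : 'I_K) (l : 'I_L) :
  outputs I J K L a b N -> into I J a -> (forall l : 'I_L, b0 l = b l :> nat) ->
  N (2 + I * J + k * L + l)%N = (b0 l == k) :> nat.
Proof.
move=> h ha hb; have hkl := ltn_pair (ltn_ord k) (ltn_ord l).
rewrite h; last lia; congr nat_of_bool; rewrite mem_cat.
have -> : ((2 + I * J + k * L + l)%N \in
    [seq 2 + (i * J + a i) | i <- iota 0 I]) = false.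
  apply/negbTE/mapP => -[i]; rewrite mem_iota => /= hi.
  by have := ltn_pair hi (ha i hi); lia.
rewrite orFb; apply/mapP/eqP => [[l']|<-]; last first.
  by exists (val l); rewrite ?mem_iota ?ltn_ord //= -hb !addnA.
rewrite mem_iota add0n => /= hl' e.
have hl : (l < L)%N by [].
have {}e : (k * L + l = b l' * L + l')%N by lia.
have L0 : (0 < L)%N by exact: leq_ltn_trans hl.
have el : l' = l.
  have := congr1 (fun x => x %% L)%N e.
  by rewrite !modnMDl !modn_small.
apply: val_inj; rewrite /= hb -el; apply/eqP; rewrite -(eqn_pmul2r L0).
by apply/eqP; lia.
Qed.

End Domination.

(** * The two algorithms *)

Lemma halted_step (R : realType) P (s : state R) : halted P s -> step P s = s.
Proof. by rewrite /halted /step; case: nth. Qed.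

Lemma halted_iter (R : realType) P k (s : state R) :
  halted P s -> iter k (step P) s = s.
Proof. by move=> h; elim: k => //= k ->; rewrite halted_step. Qed.

(** Although [exec] stops at the first halted state and iteration runs on, they agree because [step]
    fixes halted states. *)
Lemma execE (R : realType) P t (s : state R) :
  exec P t s =
  if halted P (iter t (step P) s) then Some (iter t (step P) s) else None.
Proof.
elim: t s => [//|t IH] s; rewrite iterSr /= IH; case: ifP => // h.
by rewrite halted_step // halted_iter ?h.
Qed.

Lemma wp_run (R : realType) c T (Q : assertion R) N X : wp c T Q N X ->
  let P := compile 0 c in let s0 := State 0 N X in
  exists s, [/\ runs_to P s0 s, Q (nmem s) (rmem s) &
    forall T', T <= T' -> halts_within P T' s0].
Proof.
move=> h P s0; have [|t [N' [X' [ht e q]]]] := h P 0.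
  by move=> k _; rewrite add0n.
(* Control ends just past the last instruction, where [nth] returns its default [Halt]. *)
have hP : halted P (State (0 + csize c) N' X').
  by rewrite /halted /= nth_default // size_compile.
exists (State (0 + csize c) N' X'); split=> //.
  by exists t; rewrite execE e hP.
move=> T' hT; rewrite /halts_within execE -(subnK (leq_trans ht hT)) iterD e.
by rewrite halted_iter // hP.
Qed.

(** The search makes I J + 2 evaluations of O(I K L) steps each; the output phase is of lower
    order. *)
Lemma tmain_le I J K L : 0 < I -> 0 < J -> 0 < K -> 0 < L ->
  tmain I J K L <= 400 * (I * J * (I * K * L)).
Proof.
move=> I0 J0 K0 L0.
have h1 : trow I <= 8 * I by rewrite /trow; lia.
have h2 : tlbody I K <= 42 * (I * K) by rewrite /tlbody /twcalc; nia.
have h3 : teval I K L <= 60 * (I * K * L).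
  have : L * (tlbody I K).+1 <= L * (43 * (I * K)) by rewrite leq_mul2l; nia.
  have : I <= I * K * L by nia.
  by rewrite /teval; nia.
have p1 : 0 < I * K * L by rewrite !muln_gt0 I0 K0.
move: h3 p1; rewrite /tmain /tsearch; set e := teval I K L; set w := I * K * L.
move=> h3 p1.
have q0 : w <= I * J * w by rewrite leq_pmull // muln_gt0 I0.
have q1 : J <= I * J * w by rewrite -mulnA mulnCA leq_pmulr // muln_gt0 I0.
have q2 : L <= w by rewrite leq_pmull // muln_gt0 I0.
have q3 : I <= w by rewrite /w -mulnA leq_pmulr // muln_gt0 K0.
have q4 : I * J <= I * J * w by rewrite leq_pmulr.
have q5 : I * J * e <= 60 * (I * J * w) by rewrite mulnCA leq_mul2l h3 orbT.
have -> : J * (1 + (I * (e + (6 + 1)).+1 + 3)).+1 = I * J * e + 8 * (I * J) + 5 * J.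
  by lia.
by lia.
Qed.

Lemma tsetup_le I J L : 0 < I -> 0 < J -> 0 < L ->
  tsetup I J L <= 30 * (I * J * L).
Proof.
move=> I0 J0 L0; rewrite /tsetup /tmul.
have h1 : I <= I * J * L by rewrite -mulnA leq_pmulr // muln_gt0 J0.
have h2 : J <= I * J * L by rewrite -mulnA mulnCA leq_pmulr // muln_gt0 I0.
have h3 : L <= I * J * L by rewrite leq_pmull // muln_gt0 I0.
by lia.
Qed.

Definition solver1 : cmd :=
  Seq (Ops [:: NAdd rawI 0 zero; NAdd rawJ 1 zero; NAdd rawK 0 zero; NAdd rawL 1 zero])
  (Seq setup (Seq (Ops assign) main)).

(** The swapped strides overwrite the normal ones exactly when n <= m: the threshold family then
    sits on the map whose second count covers the larger of m^2 n^n and m^m n^2. *)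
Definition solver2 : cmd :=
  Seq (Ops [:: NAdd rawI 0 zero; NAdd rawJ 0 zero; NAdd rawK 1 zero; NAdd rawL 1 zero])
  (Seq setup (Seq (Ops assign) (Seq (SkipLt 0 1 (Ops assign_swapped)) main))).

Definition inputN (m n a : nat) : nat :=
  if a == 0 then m else if a == 1 then n else 0.

Lemma solver1_spec (R : realType) m n (X : nat -> R) : 0 < m -> 0 < n ->
  wp solver1 (500 * (m ^ 3 * n ^ 3)) (fun N' _ => normal_optimum m n m n X N')
    (inputN m n) X.
Proof.
move=> m0 n0.
apply: (@wp_conseq _ _ (4 + (tsetup m n n + (14 + tmain m n m n)))
  _ (fun N' _ => normal_optimum m n m n X N')) => //.
  apply: wp_seq; apply: wp_opsI => //=; rewrite /inputN /= !addn0.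
  apply: wp_seq; apply: wp_conseq (leqnn _).
    by apply: (@setup_spec _ m n m n); rewrite ?m0.
  move=> N1 X1 [-> prep _ _ hz]; apply: wp_seq; apply: (wp_assign prep) => N2 as2.
  have [_ _ _ _ f2] := as2.
  apply: (main_normal X m0 n0 m0 n0 prep as2) => // t ht; rewrite f2; last by rewrite orbC; lia.
  by rewrite hz //= !ifF //; apply/negbTE; lia.
have := tmain_le m0 n0 m0 n0; have := tsetup_le m0 n0 n0.
have p1 : m * n * n <= m ^ 3 * n ^ 3.
  have -> : m * n * n = m ^ 1 * n ^ 2 by lia.
  by apply: leq_mul; rewrite leq_pexp2l.
have p2 : m * n * (m * m * n) <= m ^ 3 * n ^ 3.
  have -> : m * n * (m * m * n) = m ^ 3 * n ^ 2 by lia.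
  by rewrite leq_mul2l leq_pexp2l // orbT.
have p3 : 0 < m ^ 3 * n ^ 3 by rewrite muln_gt0 !expn_gt0 m0 n0.
by lia.
Qed.

(** The normal search takes O(m^3 n^2) steps and the swapped one O(m^2 n^3). *)
Lemma solver2_spec (R : realType) m n (X : nat -> R) : 0 < m -> 0 < n ->
  wp solver2 (500 * (m ^ 3 * n ^ 3)) (fun N' _ =>
    if m < n then normal_optimum m m n n X N' else swapped_optimum m m n n X N')
    (inputN m n) X.
Proof.
move=> m0 n0.
set Q : assertion R := fun N' _ => if m < n then _ else _.
have t1 := tmain_le m0 m0 n0 n0; have t2 := tmain_le n0 n0 m0 m0.
have p2 : m * m * (m * n * n) <= m ^ 3 * n ^ 3.
  have -> : m * m * (m * n * n) = m ^ 3 * n ^ 2 by lia.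
  by rewrite leq_mul2l leq_pexp2l // orbT.
have p3 : n * n * (n * m * m) <= m ^ 3 * n ^ 3.
  have -> : n * n * (n * m * m) = m ^ 2 * n ^ 3 by lia.
  by rewrite leq_mul2r leq_pexp2l // orbT.
set W := m ^ 3 * n ^ 3 in p2 p3 *.
apply: (@wp_conseq _ _ (4 + (tsetup m m n + (14 + (15 + 400 * W)))) _ Q) => //.
  apply: wp_seq; apply: wp_opsI => //=; rewrite /inputN /= !addn0.
  apply: wp_seq; apply: wp_conseq (leqnn _).
    by apply: (@setup_spec _ m m n n); rewrite ?m0.
  move=> N1 X1 [-> prep e0 e1 hz].
  have {}hz t : 64 <= t -> N1 t = 0.
    by move=> ht; rewrite hz //= !ifF //; apply/negbTE; lia.
  apply: wp_seq; apply: (wp_assign prep) => N2 as2.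
  have [_ _ _ _ f2] := as2.
  have hz2 t : 64 <= t -> N2 t = 0 by move=> ht; rewrite f2 ?hz //; lia.
  apply: (@wp_seq _ _ _ 15); apply: wp_skiplt; rewrite !f2 // e0 e1 /inputN /= => hmn.
    apply: wp_conseq (main_normal X m0 m0 n0 n0 prep as2 hz2) _ _; last by lia.
    by rewrite /Q hmn.
  have prep2 : prepared m m n n N2 by move: prep; rewrite /prepared !f2.
  apply: (wp_assign_swapped prep2) => N3 as3.
  have [_ _ _ _ f3] := as3.
  have hz3 t : 64 <= t -> N3 t = 0 by move=> ht; rewrite f3 ?hz2 //; lia.
  apply: wp_conseq (main_swapped X m0 m0 n0 n0 prep2 as3 hz3) _ _; last by lia.
  by rewrite /Q ltnNge hmn.
have := tsetup_le m0 m0 n0.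
have p1 : m * m * n <= W.
  have -> : m * m * n = m ^ 2 * n ^ 1 by lia.
  by apply: leq_mul; rewrite leq_pexp2l.
have p4 : 0 < W by rewrite muln_gt0 !expn_gt0 m0 n0.
by lia.
Qed.

(** * From the final memory to the domination counts *)

Section Guarantees.

Variables (R : realType) (I J K L : nat).
Variables (q : nat -> nat -> nat -> nat -> R) (c d : nat -> nat -> R).
Variables (X : nat -> R) (N : nat -> nat).
Hypothesis hX : stored I J K L q c d X.

Local Notation dom v := #|@dominated R I J K L q c d v|.

Definition encodes (a : {ffun 'I_I -> 'I_J}) (b : {ffun 'I_L -> 'I_K}) : Prop :=
  (forall (i : 'I_I) (j : 'I_J), N (2 + i * J + j) = (a i == j)) /\
  (forall (k : 'I_K) (l : 'I_L), N (2 + I * J + k * L + l) = (b l == k)).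

Lemma normal_guarantee : 0 < I -> 0 < J -> 0 < K ->
  normal_optimum I J K L X N -> exists a b,
  [/\ encodes a b,
      J ^ I * K ^ L <= dom (fcost q c d a b) * (J * K) &
      I * (J - 1) * K ^ L <= dom (fcost q c d a b)].
Proof.
move=> I0 J0 K0 [r [s [b' [hs hb hN hopt]]]].
have ha : into I J (threshold r s) by move=> i _; rewrite /threshold; case: ifP.
have [a ea] := into_ffun ha; have [b eb] := into_ffun hb.
exists a, b.
have [|h1 h2] := @count_normal R I J K L q c d (fcost q c d a b) I0 J0 K0.
  move=> a1 b1 r1 s1 hr1 hs1 e1; have [b1' hb1 eb1] := ffun_into b1.
  by rewrite -(objectiveE hX ea eb) -(objectiveE hX e1 eb1) hopt.
split=> //; split=> [i j|k l]; first exact: outputs_row hN hb ea.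
exact: outputs_col hN ha eb.
Qed.

Lemma swapped_guarantee : 0 < J -> 0 < K -> 0 < L ->
  swapped_optimum I J K L X N -> exists a b,
  [/\ encodes a b,
      J ^ I * K ^ L <= dom (fcost q c d a b) * (J * K) &
      L * (K - 1) * J ^ I <= dom (fcost q c d a b)].
Proof.
move=> J0 K0 L0 [r [s [a' [hs ha hN hopt]]]].
have hb : into L K (threshold r s) by move=> l _; rewrite /threshold; case: ifP.
have [a ea] := into_ffun ha; have [b eb] := into_ffun hb.
exists a, b.
have [|h1 h2] := @count_swapped R I J K L q c d (fcost q c d a b) J0 K0 L0.
  move=> a1 b1 r1 s1 hr1 hs1 e1; have [a1' ha1 ea1] := ffun_into a1.
  by rewrite -(objectiveE hX ea eb) -(objectiveE hX ea1 e1) hopt.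
split=> //; split=> [i j|k l]; first exact: outputs_row hN hb ea.
exact: outputs_col hN ha eb.
Qed.

End Guarantees.

(** * Decoding of the input layout *)

Lemma divn_pair i j J : j < J -> (i * J + j) %/ J = i.
Proof. by move=> h; rewrite divnMDl ?divn_small ?addn0 //; case: J h. Qed.

Lemma modn_pair i j J : j < J -> (i * J + j) %% J = j.
Proof. by move=> h; rewrite modnMDl modn_small. Qed.

Lemma qaddr_decode J K L i j k l : j < J -> k < K -> l < L ->
  [/\ qaddr J K L i j k l %/ (J * K * L) = i,
      (qaddr J K L i j k l %/ (K * L)) %% J = j,
      (qaddr J K L i j k l %/ L) %% K = k &
      qaddr J K L i j k l %% L = l].
Proof.
move=> hj hk hl; have h1 := ltn_pair hk hl; have h2 := ltn_pair hj h1.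
have -> : J * K * L = J * (K * L) by rewrite mulnA.
have e1 : qaddr J K L i j k l = (i * J + j) * (K * L) + (k * L + l).
  by rewrite /qaddr; lia.
have e2 : qaddr J K L i j k l = i * (J * (K * L)) + (j * (K * L) + (k * L + l)).
  by rewrite e1; lia.
by split; [rewrite e2 divn_pair | rewrite e1 divn_pair // modn_pair |
  rewrite /qaddr divn_pair // modn_pair | rewrite /qaddr modn_pair].
Qed.

Lemma stored_init1 (R : realType) m n (Q : nat -> nat -> nat -> nat -> R) c d :
  stored m n m n Q c d (rmem (init1 m n Q c d)).
Proof.
split=> [i j k l hi hj hk hl|i j hi hj|k l hk hl] /=.
- have [-> -> -> ->] := qaddr_decode i hj hk hl.
  by rewrite (qaddr_lt hi hj hk hl).
- have h := ltn_pair hi hj.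
  by rewrite ifF ?ltn_add2l ?h ?addKn ?divn_pair ?modn_pair //; apply/negbTE; lia.
- have h := ltn_pair hk hl.
  rewrite ifF; last by apply/negbTE; lia.
  rewrite ifF; last by apply/negbTE; lia.
  rewrite ifT; last by lia.
  by rewrite -addnA !addKn divn_pair // modn_pair.
Qed.

Lemma stored_init2 (R : realType) m n (Q : nat -> nat -> nat -> nat -> R) c d :
  stored m m n n Q c d (rmem (init2 m n Q c d)).
Proof.
split=> [i j k l hi hj hk hl|i j hi hj|k l hk hl] /=.
- have [-> -> -> ->] := qaddr_decode i hj hk hl.
  by rewrite (qaddr_lt hi hj hk hl).
- have h := ltn_pair hi hj.
  by rewrite ifF ?ltn_add2l ?h ?addKn ?divn_pair ?modn_pair //; apply/negbTE; lia.
- have h := ltn_pair hk hl.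
  rewrite ifF; last by apply/negbTE; lia.
  rewrite ifF; last by apply/negbTE; lia.
  rewrite ifT; last by lia.
  by rewrite -addnA !addKn divn_pair // modn_pair.
Qed.

(** It suffices to take base 5, where the induction on m starts from 25 <= 125 and uses (k + 6)^2 <=
    5 (k + 5)^2. *)
Lemma sqr_le_exp m n : 4 < m -> 4 < n -> m ^ 2 <= n ^ (m - 2).
Proof.
move=> hm hn; apply: (@leq_trans (5 ^ (m - 2))); last by rewrite leq_exp2r //; lia.
have [k ->] : exists k, m = k + 5 by exists (m - 5); lia.
have -> : k + 5 - 2 = k + 3 by lia.
elim: k => // k IH; rewrite [k.+1 + 3]addSn [leqRHS]expnS.
by apply: (@leq_trans (5 * (k + 5) ^ 2)); [nia | rewrite leq_mul2l IH].
Qed.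

Lemma average_bound m n I L g : 0 < m -> 0 < n -> 0 < I -> 0 < L ->
  m ^ I * n ^ L <= g * (m * n) -> m ^ (I - 1) * n ^ (L - 1) <= g.
Proof.
move=> m0 n0 I0 L0 h; have mn0 : 0 < m * n by rewrite muln_gt0 m0.
rewrite -(leq_pmul2r mn0) (leq_trans _ h) // mulnACA -!expnSr.
by rewrite !subn1 !prednK.
Qed.

(** Each of the three terms is at most the averaging count: after cancellation, a b^(a+1) <= a^(b-1)
    b^(a-1) becomes b^2 <= a^(b-2). *)
Lemma bound1_le m n g : 4 < m -> 4 < n ->
  n ^ m * m ^ n <= g * (n * m) -> bound1 m n <= 3 * g.
Proof.
move=> hm hn h.
have {h} h : n ^ (m - 1) * m ^ (n - 1) <= g by apply: average_bound h; lia.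
have exchange a b : 4 < a -> 4 < b -> b ^ (a + 1) * a <= a ^ (b - 1) * b ^ (a - 1).
  move=> ha hb; have -> : a + 1 = (a - 1) + 2 by lia.
  have -> : b - 1 = (b - 2) + 1 by lia.
  rewrite !expnD expn1; have := sqr_le_exp hb ha.
  move: (b ^ (a - 1)) (b ^ 2) (a ^ (b - 2)) => u v w huv.
  have -> : u * v * a = u * a * v by lia.
  have -> : w * a * u = u * a * w by lia.
  by rewrite leq_mul2l huv orbT.
have := exchange n m hn hm; have := exchange m n hm hn.
by rewrite /bound1 [m ^ (n - 1) * _]mulnC [m * _]mulnC; lia.
Qed.

(** The constant is 1 + 2 + 1: the averaging count covers the first term and, since m n^2 <= n^3 <=
    n^(n-1), the third; the threshold count covers half of the second, as m <= 2 (m - 1). *)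
Lemma bound2_le m n g : 4 < m -> m <= n ->
  m ^ m * n ^ n <= g * (m * n) -> m * (m - 1) * n ^ n <= g ->
  bound2 m n <= 4 * g.
Proof.
move=> hm hn h h2.
have {h} h : m ^ (m - 1) * n ^ (n - 1) <= g by apply: average_bound h; lia.
have h3 : m ^ m * n ^ 2 <= m ^ (m - 1) * n ^ (n - 1).
  have -> : m ^ m = m ^ (m - 1) * m by rewrite -expnSr subn1 prednK //; lia.
  rewrite -mulnA leq_mul2l; apply/orP; right.
  apply: (@leq_trans (n ^ 3)); first by rewrite [n ^ 3]expnS leq_mul2r hn orbT.
  by rewrite leq_pexp2l; lia.
have h4 : m ^ 2 * n ^ n <= 2 * (m * (m - 1) * n ^ n).
  by rewrite mulnA leq_mul2r; apply/orP; right; nia.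
by rewrite /bound2; lia.
Qed.

Lemma bound2C m n : bound2 m n = bound2 n m.
Proof.
rewrite /bound2 addnAC.
by rewrite [m ^ (m - 1) * _]mulnC [m ^ m * _]mulnC [m ^ 2 * _]mulnC.
Qed.

Lemma f1E (R : realType) m n (Q : nat -> nat -> nat -> nat -> R) c d
    (x y : 'M[bool]_(m, n)) : f1 Q c d x y = fmx Q c d x y.
Proof.
rewrite /f1 /fmx; congr (_ + _ + _)%R.
by apply: eq_bigr => i _; rewrite exchange_big.
Qed.

(* Domination number >= bound  <=>  every instance's dominated count >= bound.
   Omega(E): exists K, E <= K * count for all m, n >= N0.
   O(m^3 n^3): halts within C * m^3 * n^3 steps for all m, n >= N0. *)
Theorem theorem6 :
  (exists (P : program) (C K N0 : nat),
     forall (R : realType) (m n : nat) (Q : nat -> nat -> nat -> nat -> R)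
            (c d : nat -> nat -> R),
       (0 < m)%N -> (0 < n)%N ->
       exists s : state R,
         runs_to P (init1 m n Q c d) s /\ valid_out1 m n s /\
         ((N0 <= m)%N -> (N0 <= n)%N ->
            halts_within P (C * (m ^ 3 * n ^ 3)) (init1 m n Q c d) /\
            (bound1 m n <= K * dom_count1 m n Q c d s)%N))
  /\
  (exists (P : program) (C K N0 : nat),
     forall (R : realType) (m n : nat) (Q : nat -> nat -> nat -> nat -> R)
            (c d : nat -> nat -> R),
       (0 < m)%N -> (0 < n)%N ->
       exists s : state R,
         runs_to P (init2 m n Q c d) s /\ valid_out2 m n s /\
         ((N0 <= m)%N -> (N0 <= n)%N ->
            halts_within P (C * (m ^ 3 * n ^ 3)) (init2 m n Q c d) /\
            (bound2 m n <= K * dom_count2 m n Q c d s)%N)).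
Proof.
split.
(* The step factor 500 comes from [solver1_spec], the factor 3 and the threshold 5 from
   [bound1_le]. *)
- exists (compile 0 solver1), 500, 3, 5 => R m n Q c d m0 n0.
  have [s [hrun hopt hhalt]] :=
    wp_run (solver1_spec (rmem (init1 m n Q c d)) m0 n0).
  have [a [b [[ea eb] hcount _]]] :=
    normal_guarantee (stored_init1 m n Q c d) m0 n0 m0 hopt.
  have ex : outx1 m n s = row_choice a.
    by apply/matrixP => i j; rewrite !mxE ea; case: (a i == j).
  have ey : outy1 m n s = col_choice b.
    by apply/matrixP => i j; rewrite !mxE eb; case: (b j == i).
  exists s; split; first exact: hrun.
  split.
    rewrite /valid_out1 ex ey; apply/andP; split; last exact: feasible_choice.
    apply/forallP => i; apply/forallP => j; rewrite ea eb.
    by case: (a i == j); case: (b j == i).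
  move=> hm hn; split; first exact: hhalt.
  apply: leq_trans (bound1_le hm hn hcount) _; rewrite leq_mul2l /=.
  apply: leq_trans (dominated_card _ _ _ _ _ _ _ _) _; rewrite /dom_count1 ex ey.
  apply: subset_leq_card; apply/subsetP => p; rewrite !inE !f1E fmx_choice.
  exact: id.
exists (compile 0 solver2), 500, 4, 5 => R m n Q c d m0 n0.
have [s [hrun hopt hhalt]] :=
  wp_run (solver2_spec (rmem (init2 m n Q c d)) m0 n0).
have [a [b [[ea eb] hbound]]] : exists (a : {ffun 'I_m -> 'I_m})
    (b : {ffun 'I_n -> 'I_n}), encodes (nmem s) a b /\ (4 < m -> 4 < n ->
    bound2 m n <= 4 * #|dominated m m n n Q c d (fcost Q c d a b)|).
  move: hopt; case: ltnP => hmn hopt.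
    have [a [b [h1 h2 h3]]] :=
      normal_guarantee (stored_init2 m n Q c d) m0 m0 n0 hopt.
    by exists a, b; split=> // hm hn; apply: bound2_le => //; apply: ltnW.
  have [a [b [h1 h2 h3]]] :=
    swapped_guarantee (stored_init2 m n Q c d) m0 n0 n0 hopt.
  (* Here n <= m, and the symmetry of the bound lets the same estimate apply with m and n
     exchanged. *)
  exists a, b; split=> // hm hn; rewrite bound2C; apply: bound2_le => //.
  by rewrite mulnC [n * m]mulnC.
have ex : outx2 m s = row_choice a.
  by apply/matrixP => i j; rewrite !mxE ea; case: (a i == j).
have ey : outy2 m n s = col_choice b.
  by apply/matrixP => i j; rewrite !mxE eb; case: (b j == i).
exists s; split; first exact: hrun.
split.
  rewrite /valid_out2 ex ey; apply/andP; split; last exact: feasible_choice.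
  apply/andP; split; apply/forallP => i; apply/forallP => j.
    by rewrite ea; case: (a i == j).
  by rewrite eb; case: (b j == i).
move=> hm hn; split; first exact: hhalt.
apply: leq_trans (hbound hm hn) _; rewrite leq_mul2l /=.
apply: leq_trans (dominated_card _ _ _ _ _ _ _ _) _; rewrite /dom_count2 ex ey.
have fE x y : f2 Q c d x y = fmx Q c d x y by [].
apply: subset_leq_card; apply/subsetP => p; rewrite !inE !fE fmx_choice.
exact: id.
Qed.
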